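(* Assume $\Theta\subset\mathbb R^d$ is compact and convex, and let $0<\delta<\epsilon$. Let $D=\sup_{\theta,\theta'\in\Theta}\|\theta-\theta'\|$. Assume there exists a measurable map $L:\mathcal X\times\mathcal Y\to(0,\infty)$ with $\mathbb E[\exp(tL(X,Y))]<\infty$ for all $t$ in some neighbourhood of $0$, such that for all $\theta,\theta'\in\Theta$, $$|g(\theta,X,Y)-g(\theta',X,Y)|\le L(X,Y)\|\theta-\theta'\|\quad\text{a.s.}$$ Let $\bar L=\mathbb E[L(X,Y)]$ and assume there exist $\ell_1,\ell_2>0$ with $$|L(X,Y)-\mathbb E[L(X,Y)\mid Y]|\le\ell_1\ \text{a.s.},\qquad|\mathbb E[L(X,Y)\mid Y]-\bar L|\le\ell_2\ \text{a.s.},$$ and $b_1,b_2>0$ such that for every $t\in\mathbb R$ and all $\theta,\theta'\in\Theta$: $$\mathcal M(\theta,\theta',t,Y)\le\exp\Big(\mathbb E[\Gamma(\theta,\theta',X,Y)\mid Y]\,t+\frac{b_1^2t^2}{2}\Big)\ \text{a.s.},\quad \mathbb E\big[\exp\big(t\,\mathbb E[\Gamma(\theta,\theta',X,Y)\mid Y]\big)\big]\le\exp\Big(\mathbb E[\Gamma(\theta,\theta',X,Y)]\,t+\frac{b_2^2t^2}{2}\Big).$$ Then, for every $M,N\ge1$ and every hierarchical sample $(X^{k,l},Y^k)_{1\le k\le M,1\le l\le N}$ of $(X,Y)$, writing $S^\epsilon=S^\epsilon(\Theta)$ and $\hat S^\delta_{M,N}=\hat S^\delta_{M,N}(\Theta)$,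 $$\mathbb P\big(\hat S^\delta_{M,N}\not\subset S^\epsilon\big)\le\inf_{L'>\bar L}\Big\{\Big(\Big(\frac{8L'D}{\epsilon-\delta}+1\Big)^d+1\Big)\exp\Big(\frac{-M(\epsilon-\delta)^2}{8(b_1^2/N+b_2^2)}\Big)+\exp\Big(\frac{-M(L'-\bar L)^2}{2(\ell_1^2/N+\ell_2^2)}\Big)\Big\}.$$
   Context: $X$ and $Y$ are random variables with values in measurable spaces $\mathcal X$ and $\mathcal Y$. A hierarchical sample of size $M\times N$ of $(X,Y)$ consists of random variables $Y^1,\dots,Y^M$ and $X^{k,l}$, $1\le k\le M$, $1\le l\le N$, such that the blocks $(Y^k,X^{k,1},\dots,X^{k,N})$ are i.i.d. over $k$, each $Y^k$ has the law of $Y$, and, conditionally on $Y^k$, $X^{k,1},\dots,X^{k,N}$ are i.i.d. with the conditional law of $X$ given $Y=Y^k$. $g:\Theta\times\mathcal X\times\mathcal Y\to\mathbb R$ is measurable with $g(\theta,X,Y)$ integrable for every $\theta$. Define $G(\theta)=\mathbb E[g(\theta,X,Y)]$ and $\hat G_{M,N}(\theta)=\frac1{MN}\sum_{k=1}^M\sum_{l=1}^N g(\theta,X^{k,l},Y^k)$. For $\epsilon>0$ and non-empty $E\subset\Theta$, $S^\epsilon(E)=\{\theta\in E: G(\theta)\le\min_E G+\epsilon\}$ and $\hat S^\epsilon_{M,N}(E)=\{\theta\in E:\hat G_{M,N}(\theta)\le\min_E\hat G_{M,N}+\epsilon\}$. For $\theta,\theta'\in\Theta$, $t\in\mathbb R$,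 $y\in\mathcal Y$: $\Gamma(\theta,\theta',X,Y)=g(\theta',X,Y)-g(\theta,X,Y)$ and $\mathcal M(\theta,\theta',t,y)=\mathbb E[\exp(t\Gamma(\theta,\theta',X,Y))\mid Y=y]$.
   Formalization: The Lipschitz bound is assumed almost surely simultaneously for all θ, θ' in Θ (one null set of values of (X,Y) for all pairs); with a null set depending on the pair the claim fails, e.g. Θ=[0,1], X uniform, g = θ − 1000·1{X=θ}. *)

(* Defs.v *)
From HB Require Import structures.
From mathcomp Require Import all_boot all_order all_algebra.
From mathcomp Require Import all_classical all_reals all_analysis.
Set Implicit Arguments. Unset Strict Implicit. Unset Printing Implicit Defensive.
Import Order.TTheory GRing.Theory Num.Theory.
Import numFieldNormedType.Exports.
Local Open Scope classical_set_scope.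
Local Open Scope ring_scope.

Definition enorm (R : realType) (d : nat) (v : 'rV[R]_d) : R :=
  Num.sqrt (\sum_(i < d) v ord0 i ^+ 2).

Definition convexR (R : realType) (d : nat) (A : set 'rV[R]_d) : Prop :=
  forall x y (t : R), A x -> A y -> 0 <= t -> t <= 1 ->
    A (t *: x + (1 - t) *: y).

Definition diam (R : realType) (d : nat) (A : set 'rV[R]_d) : R :=
  sup [set enorm (a - b) | a in A & b in A].

(* Conditional expectation E[f(X,Y) | Y = y], computed through the regular
   conditional distribution kappa of X given Y. *)
Definition condE d1 d2 (X : measurableType d1) (Y : measurableType d2)
  (R : realType) (kappa : R.-pker Y ~> X) (f : X -> Y -> R) (y : Y) : R :=
  fine (\int[kappa y]_x (f x y)%:E)%E.

Definition reg_cond_distr dO d1 d2 (Om : measurableType dO)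
  (X : measurableType d1) (Y : measurableType d2) (R : realType)
  (P : probability Om R) (Xv : Om -> X) (Yv : Om -> Y)
  (kappa : R.-pker Y ~> X) : Prop :=
  forall (A : set X) (B : set Y), measurable A -> measurable B ->
    P (Xv @^-1` A `&` Yv @^-1` B) = (\int[P]_(w in Yv @^-1` B) kappa (Yv w) A)%E.

(* Hierarchical sample of size M x N of (Xv,Yv) on the probability space
   (Om', P'): the blocks (Ys k, Xs k 1, ..., Xs k N) are i.i.d. over k, Ys k
   has the law of Yv, and conditionally on Ys k the Xs k l are i.i.d. with
   law kappa (Ys k).  This is stated through the joint law on measurable
   rectangles (which determine it):
   P'(forall k, Ys k in B k /\ forall l, Xs k l in A k l)
     = prod_k E[ 1_{Yv in B k} prod_l kappa(Yv)(A k l) ]. *)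
Definition hier_sample dO dO' d1 d2 (Om : measurableType dO)
  (Om' : measurableType dO') (X : measurableType d1) (Y : measurableType d2)
  (R : realType) (P : probability Om R) (Yv : Om -> Y)
  (kappa : R.-pker Y ~> X) (P' : probability Om' R) (M N : nat)
  (Ys : 'I_M -> Om' -> Y) (Xs : 'I_M -> 'I_N -> Om' -> X) : Prop :=
  [/\ (forall k, measurable_fun setT (Ys k)),
      (forall k l, measurable_fun setT (Xs k l)) &
      forall (B : 'I_M -> set Y) (A : 'I_M -> 'I_N -> set X),
        (forall k, measurable (B k)) -> (forall k l, measurable (A k l)) ->
        P' (\bigcap_(k in [set: 'I_M])
              (Ys k @^-1` B k `&` \bigcap_(l in [set: 'I_N]) (Xs k l @^-1` A k l)))
        = (\prod_(k < M)
             \int[P]_(w in Yv @^-1` B k) \prod_(l < N) kappa (Yv w) (A k l))%E].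

Definition Gfun dO d1 d2 (Om : measurableType dO) (X : measurableType d1)
  (Y : measurableType d2) (R : realType) (d : nat) (P : probability Om R)
  (Xv : Om -> X) (Yv : Om -> Y) (g : 'rV[R]_d -> X -> Y -> R) (th : 'rV[R]_d) : R :=
  fine (\int[P]_w (g th (Xv w) (Yv w))%:E)%E.

Definition Ghat Om d1 d2 (X : measurableType d1) (Y : measurableType d2)
  (R : realType) (d : nat) (M N : nat) (g : 'rV[R]_d -> X -> Y -> R)
  (Ys : 'I_M -> Om -> Y) (Xs : 'I_M -> 'I_N -> Om -> X) (w : Om)
  (th : 'rV[R]_d) : R :=
  (M * N)%:R^-1 * \sum_(k < M) \sum_(l < N) g th (Xs k l w) (Ys k w).

Definition near_min (R : realType) (d : nat) (F : 'rV[R]_d -> R)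
  (E : set 'rV[R]_d) (eps : R) : set 'rV[R]_d :=
  [set th | E th /\ F th <= inf (F @` E) + eps].

(* Main.v *)
Require Import Defs.
From HB Require Import structures.
From mathcomp Require Import all_boot all_order all_algebra.
From mathcomp Require Import all_classical all_reals all_analysis.
From mathcomp Require Import measurable_realfun ring lra.
Import Order.TTheory GRing.Theory Num.Theory.
Import numFieldNormedType.Exports.
Local Open Scope classical_set_scope.
Local Open Scope ring_scope.
Set Implicit Arguments. Unset Strict Implicit. Unset Printing Implicit Defensive.

(** Put [nu = (eps - delta) / (8 L')] and let [D] be the diameter of [Theta]. A
    maximal [nu]-separated subset [c] of [Theta] is a [nu]-net. It has at most
    [q ^ d] points, [q = D / nu + 1]: if [s] is [nu]-separated then so is
    [{q x + y | x in s, y in c}], so iterating gives [(#|c|) ^ j] separated points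
    in a set of diameter at most [q ^ j nu], and a grid argument bounds their
    number by [C (q ^ d) ^ j] for all [j].

    Outside the event that the empirical mean of [L] reaches [L'], both [G] and its
    empirical version are [L']-Lipschitz, so a [delta]-minimiser of the latter
    that is not an [eps]-minimiser of [G] forces, at a nearby net point, a
    deviation of at least [(eps - delta) / 2] for the increment towards a fixed
    [(eps - delta) / 4]-minimiser of [G]. Both kinds of deviation are bounded by
    Chernoff's method, since exponentials of double sums integrate to
    [prod_k E (E (exp (s h) | Y)) ^ N]; for [L], the two sub-Gaussian hypotheses
    come from Hoeffding's lemma. *)

(** * Integrals against a mixture of measures *)

(** For finite [x] this is continuity of scaling. For [x = +oo] the product is identically 0 or
    equals [+oo] from some positive [u n0] on, and monotonicity keeps it there. *)
Lemma ge0_nd_cvgeMl (R : realType) (x : \bar R) (u : (\bar R)^nat) :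
  (0 <= x)%E -> (forall n, (0 <= u n)%E) -> nondecreasing_seq u ->
  (x * u n)%E @[n --> \oo] --> (x * limn u)%E.
Proof.
move=> x0 u0 nd; have cu : cvgn u by exact: ereal_nondecreasing_is_cvgn.
have [xfin|] := boolP (x \is a fin_num); first exact: cvgeZl.
rewrite ge0_fin_numE// -leNgt leye_eq => /eqP ->.
have [u_eq0|/existsNP[n0 un0]] := pselect (forall n, u n = 0%E).
  have uE : u = cst 0%E by apply/funext => n; exact: u_eq0.
  have -> : limn u = 0%E by rewrite uE; exact: lim_cst.
  rewrite mule0; have -> : (fun n => +oo%E * u n)%E = cst 0%E.
    by apply/funext => n; rewrite u_eq0 mule0.
  exact: cvg_cst.
have {}un0 : (0 < u n0)%E by rewrite lt0e u0 andbT; exact/eqP.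
rewrite gt0_mulye; last first.
  apply: lt_le_trans un0 _; apply: lime_ge => //.
  by exists n0 => // n /= n0n; exact: nd.
apply: cvg_near_cst; exists n0 => // n /= n0n.
by rewrite gt0_mulye// (lt_le_trans un0)// nd.
Qed.

Section mixture.
Local Open Scope ereal_scope.
Context d d' (Om : measurableType d) (Z : measurableType d') (R : realType).
Variables (mu : {measure set Om -> \bar R}) (V : Om -> \bar R).
Hypotheses (V0 : forall w, 0 <= V w) (mV : measurable_fun setT V).
Variable K : Om -> {measure set Z -> \bar R}.
Hypothesis mK : forall U, measurable U -> measurable_fun setT (K ^~ U).

(* The unused proof arguments make the measure instance below inferable. *)
Definition mixture of (forall w, 0 <= V w) & measurable_fun setT V &
    (forall U, measurable U -> measurable_fun setT (K ^~ U)) :=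
  fun C : set Z => \int[mu]_w (V w * K w C).

Let mix := mixture V0 mV mK.

Let mix0 : mix set0 = 0.
Proof.
by rewrite /mix /mixture integral0_eq// => w _; rewrite measure0 mule0.
Qed.

Let mix_ge0 C : 0 <= mix C.
Proof. by apply: integral_ge0 => w _; rewrite mule_ge0. Qed.

Let mix_sigma_additive : semi_sigma_additive mix.
Proof.
move=> U mU tU mUU; rewrite [X in _ --> X](_ : _ =
  \int[mu]_w (\sum_(n <oo) V w * K w (U n))); last first.
  apply: eq_integral => w _; apply/esym/cvg_lim => //.
  under eq_fun do rewrite -ge0_sume_distrr//.
  have -> : K w (\bigcup_n U n) = limn (fun n => \sum_(0 <= i < n) K w (U i)).
    by apply/esym/cvg_lim => //; exact/measure_semi_sigma_additive.
  apply: ge0_nd_cvgeMl => // [n|]; first exact: sume_ge0.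
  by apply: ereal_nondecreasing_series => n _ _.
apply/cvg_closeP; split.
  apply: is_cvg_nneseries => n _ _; exact: mix_ge0.
rewrite closeE// integral_nneseries//.
- by move=> n; apply: emeasurable_funM => //; exact: mK.
- by move=> n w _; rewrite mule_ge0.
Qed.

HB.instance Definition _ := isMeasure.Build _ _ R
  (mixture V0 mV mK) mix0 mix_ge0 mix_sigma_additive.

Import HBNNSimple.

Let integral_mixture_nnsfun (f : {nnsfun Z >-> R}) :
  \int[mix]_z (f z)%:E = \int[mu]_w (V w * \int[K w]_z (f z)%:E).
Proof.
under [in LHS]eq_integral do rewrite fimfunE -fsumEFin//.
rewrite ge0_integral_fsum//; last 2 first.
  - by move=> r; exact/measurable_EFinP/measurableT_comp.
  - by move=> r z _; rewrite EFinM nnfun_muleindic_ge0.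
have e w : V w * \int[K w]_z (f z)%:E =
    \sum_(r \in range f) (r%:E * (V w * K w (f @^-1` [set r]))).
  under eq_integral do rewrite fimfunE -fsumEFin//.
  rewrite /= ge0_integral_fsum//; last 2 first.
    - by move=> r; exact/measurable_EFinP/measurableT_comp.
    - by move=> r z _; rewrite EFinM nnfun_muleindic_ge0.
  rewrite ge0_mule_fsumr; last first.
    move=> r; apply: integral_ge0 => z _.
    by rewrite EFinM nnfun_muleindic_ge0.
  apply: eq_fsbigr => r _.
  rewrite (integralZl_indic _ (fun r => f @^-1` [set r]))//; last first.
    by move=> r0; rewrite preimage_nnfun0.
  by rewrite integral_indic// setIT muleCA.
under [in RHS]eq_integral do rewrite e.
(* For [r < 0] the preimage of [r] under the nonnegative [f] is empty, so the term is 0. *)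
have ge0 r w : 0 <= r%:E * (V w * K w (f @^-1` [set r])).
  have [r0|r0] := leP 0%R r; first by rewrite !mule_ge0.
  by rewrite preimage_nnfun0// measure0 !mule0.
have mVK r : measurable_fun setT (fun w => V w * K w (f @^-1` [set r])).
  by apply: emeasurable_funM => //; exact: mK.
rewrite /= ge0_integral_fsum//; last by move=> r; exact: measurable_funeM.
apply: eq_fsbigr => r _.
rewrite (integralZl_indic _ (fun r => f @^-1` [set r]))//; last first.
  exact: preimage_nnfun0.
rewrite integral_indic// setIT.
have [r0|r0] := leP 0%R r.
  by rewrite ge0_integralZl// => w _; rewrite mule_ge0.
rewrite preimage_nnfun0// measure0 mule0 integral0_eq// => w _.
by rewrite measure0 !mule0.
Qed.

(** Monotone convergence extends the identity from simple functions; the weight [V w] may be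
    infinite, hence the appeal to [ge0_nd_cvgeMl]. *)
Lemma integral_mixture (f : Z -> \bar R) :
  (forall z, 0 <= f z) -> measurable_fun setT f ->
  \int[mixture V0 mV mK]_z f z = \int[mu]_w (V w * \int[K w]_z f z).
Proof.
move=> f0 mf; rewrite -/mix.
pose f_ := nnsfun_approx measurableT mf.
have fE (m : {measure set Z -> \bar R}) :
    \int[m]_z f z = limn (fun n => \int[m]_z (f_ n z)%:E).
  rewrite -monotone_convergence//; last 3 first.
  - by move=> n; exact/measurable_EFinP.
  - by move=> n z _; rewrite lee_fin.
  - by move=> z _ a b ab; rewrite lee_fin; exact/lefP/nd_nnsfun_approx.
  by apply: eq_integral => z _; apply/esym/cvg_lim => //; exact: cvg_nnsfun_approx.
have nd (m : {measure set Z -> \bar R}) :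
    nondecreasing_seq (fun n => \int[m]_z (f_ n z)%:E).
  move=> a b ab; apply: ge0_le_integral => //.
  - by move=> z _; rewrite lee_fin.
  - exact/measurable_EFinP.
  - exact/measurable_EFinP.
  - by move=> z _; rewrite lee_fin; exact/lefP/nd_nnsfun_approx.
rewrite fE; under eq_fun do rewrite integral_mixture_nnsfun.
rewrite -monotone_convergence//; last 3 first.
- move=> n; apply: emeasurable_funM => //.
  apply: measurable_fun_integral_kernel => //.
  + by move=> z; rewrite lee_fin.
  + exact/measurable_EFinP.
- move=> n w _; rewrite mule_ge0// integral_ge0// => z _.
  by rewrite lee_fin.
- by move=> w _ a b ab; rewrite lee_wpmul2l// nd.
apply: eq_integral => w _; rewrite fE.
apply/cvg_lim => //; apply: ge0_nd_cvgeMl => // n.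
by apply: integral_ge0 => z _; rewrite lee_fin.
Qed.

End mixture.

(** * Averages under a probability kernel *)

(* Extends a property of families from [B]-valued to [E]-valued ones by changing
   one member at a time. *)
Lemma finite_family_ext (I : finType) (T : Type) (B E : set T)
    (G : (I -> T) -> Prop) :
  B `<=` E ->
  (forall i phi, (forall j, E (phi j)) ->
    (forall psi, B psi -> G (fun j => if j == i then psi else phi j)) ->
    forall psi, E psi -> G (fun j => if j == i then psi else phi j)) ->
  (forall phi, (forall j, B (phi j)) -> G phi) ->
  forall phi, (forall j, E (phi j)) -> G phi.
Proof.
move=> BE step base.
(* [s] lists the indices whose member may lie outside [B]; removing its head costs one use of
   [step]. *)
suff main (s : seq I) (phi : I -> T) : (forall j, E (phi j)) ->
    (forall j, j \notin s -> B (phi j)) -> G phi.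
  by move=> phi Ephi; apply: (main (enum I)) => // j; rewrite mem_enum.
elim: s phi => [phi Ephi Bphi|i s ih phi Ephi Bphi].
  by apply: base => j; exact: Bphi.
have -> : phi = (fun j => if j == i then phi i else phi j).
  by apply/funext => j; case: eqP => [->|].
apply: step => // psi Bpsi; apply: ih => j.
  by case: eqP => // _; exact: BE.
have [//|ji js] := eqVneq j i.
by apply: Bphi; rewrite inE negb_or ji.
Qed.

(** Rectangles form a pi-system generating the product sigma-algebra. The cover is the constant
    sequence [setT], whence the finiteness condition on [m1]. *)
Lemma measure_eq_rectangles (R : realType) d1 d2 (X : measurableType d1)
    (Y : measurableType d2) (m1 m2 : {measure set (X * Y) -> \bar R}) :
  (m1 setT < +oo)%E ->
  (forall A B, measurable A -> measurable B -> m1 (A `*` B) = m2 (A `*` B)) ->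
  forall C, measurable C -> m1 C = m2 C.
Proof.
move=> m1oo h.
apply: (@measure_unique _ _ _
  [set A `*` B | A in measurable & B in measurable] (fun=> setT)).
- exact: measurable_prod_measurableType.
- move=> _ _ [A mA [B mB <-]] [A' mA' [B' mB' <-]].
  exists (A `&` A'); first exact: measurableI.
  by exists (B `&` B'); [exact: measurableI|rewrite setXI].
- by move=> _; exists setT => //; exists setT => //; rewrite setXTT.
- by rewrite bigcup_const.
- by move=> _ [A mA [B mB <-]]; exact: h.
- by [].
Qed.

Lemma prode_ge0 (R : realType) (I : Type) (r : seq I) (Q : pred I)
    (F : I -> \bar R) :
  (forall i, Q i -> (0 <= F i)%E) -> (0 <= \prod_(i <- r | Q i) F i)%E.
Proof.
by move=> F0; elim/big_ind : _ => // x y x0 y0; exact: mule_ge0.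
Qed.

Lemma lee_prod_nng (R : realType) (I : Type) (r : seq I) (F G : I -> \bar R) :
  (forall i, (0 <= F i <= G i)%E) ->
  (\prod_(i <- r) F i <= \prod_(i <- r) G i)%E.
Proof.
move=> FG; suff /andP[] : (0 <= \prod_(i <- r) F i <= \prod_(i <- r) G i)%E by [].
elim/big_ind2 : _ => // [|x y x' y' /andP[x0 xy] /andP[x'0 xy']].
  by rewrite lexx lee01.
by rewrite mule_ge0//= lee_pmul.
Qed.

Lemma emeasurable_prod d (T : measurableType d) (R : realType) (I : Type)
    (r : seq I) (Q : pred I) (h : I -> T -> \bar R) :
  (forall i, Q i -> measurable_fun setT (h i)) ->
  measurable_fun setT (fun x => \prod_(i <- r | Q i) h i x)%E.
Proof.
move=> mh; elim: r => [|i r ih].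
  by under eq_fun do rewrite big_nil; exact: measurable_cst.
under eq_fun do rewrite big_cons.
have [Qi|//] := boolP (Q i).
by apply: emeasurable_funM => //; exact: mh.
Qed.

Section kernel_average.
Local Open Scope ereal_scope.
Context d1 d2 (X : measurableType d1) (Y : measurableType d2) (R : realType).

Definition pairr (y : Y) (x : X) : X * Y := (x, y).

Lemma measurable_pairr y : measurable_fun setT (pairr y).
Proof. by apply: measurable_fun_pair => //; exact: measurable_id. Qed.

Variable kappa : R.-pker Y ~> X.

(** The conditional expectation of [psi] at [Y = y], kept in the extended reals, unlike [condE]. *)
Definition kavg (psi : X * Y -> \bar R) (y : Y) := \int[kappa y]_x psi (x, y).

(** The product of [kappa y] with the Dirac mass at [y], bundled as a measure so that it can serve
    as the [K] of a mixture. *)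
Definition kpair (y : Y) : {measure set (X * Y) -> \bar R} :=
  measure_function_pushforward__canonical__measure_function_Measure
    (kappa y) (measurable_pairr y).

Lemma integral_kpair psi y : (forall z, 0 <= psi z) -> measurable_fun setT psi ->
  \int[kpair y]_z psi z = kavg psi y.
Proof.
move=> psi0 mpsi; rewrite /kpair (ge0_integral_pushforward (measurable_pairr y))//.
Qed.

Lemma kavg_ge0 psi y : (forall z, 0 <= psi z) -> 0 <= kavg psi y.
Proof. by move=> psi0; exact: integral_ge0. Qed.

Lemma measurable_kavg psi : (forall z, 0 <= psi z) -> measurable_fun setT psi ->
  measurable_fun setT (kavg psi).
Proof.
move=> psi0 mpsi.
(* The kernel goes from [Y] to [X], so the integrand is transported to [Y * X]. *)
apply: (measurable_fun_integral_finite_kernel (fun z : Y * X => psi (z.2, z.1))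
  kappa) => //.
by apply: measurableT_comp => //; exact: measurable_fun_pair.
Qed.

Lemma kavg_indic C y : measurable C ->
  kavg (fun z => (\1_C z)%:E) y = kpair y C.
Proof.
move=> mC; rewrite -integral_kpair//; last exact/measurable_EFinP.
by rewrite integral_indic// setIT.
Qed.

Lemma measurable_kpair C : measurable C -> measurable_fun setT (kpair ^~ C).
Proof.
move=> mC; under eq_fun do rewrite -kavg_indic//.
by apply: measurable_kavg => //; exact/measurable_EFinP.
Qed.

Lemma kavg_rect (A : set X) (B : set Y) y : measurable A -> measurable B ->
  kavg (fun z => (\1_(A `*` B) z)%:E) y = (\1_B y)%:E * kappa y A.
Proof.
move=> mA mB; rewrite kavg_indic; last exact: measurableX.
rewrite /kpair /pushforward indicE.
have [yB|yB] := boolP (y \in B).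
  rewrite mul1e; congr (kappa y _).
  by apply/seteqP; split => [x []//|x Ax]; split => //=; exact/set_mem.
rewrite mul0e -(measure0 (kappa y)); congr (kappa y _).
by apply/seteqP; split => // x [_ /= By]; rewrite mem_set in yB.
Qed.

End kernel_average.

(** * The law of a hierarchical sample *)

Section hierarchical_product.
Local Open Scope ereal_scope.
Context dO dO' d1 d2 (Om : measurableType dO) (Om' : measurableType dO')
  (X : measurableType d1) (Y : measurableType d2) (R : realType).
Variables (P : probability Om R) (Yv : Om -> Y) (kappa : R.-pker Y ~> X)
  (P' : probability Om' R) (M N : nat).
Variables (Ys : 'I_M -> Om' -> Y) (Xs : 'I_M -> 'I_N -> Om' -> X).
Hypothesis mYv : measurable_fun setT Yv.
Hypothesis hs : hier_sample P Yv kappa P' Ys Xs.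

Let I := ('I_M * 'I_N)%type.
Implicit Types (phi : I -> X * Y -> \bar R) (psi : X * Y -> \bar R).

Let Zs (p : I) (w : Om') : X * Y := (Xs p.1 p.2 w, Ys p.1 w).

Let nnm : set (X * Y -> \bar R) :=
  [set psi | (forall z, 0 <= psi z) /\ measurable_fun setT psi].

Let lhs phi : \bar R := \int[P']_w \prod_(p : I) phi p (Zs p w).

Let rhs phi : \bar R :=
  \prod_(k < M) \int[P]_w \prod_(l < N) kavg kappa (phi (k, l)) (Yv w).

Let mZs p : measurable_fun setT (Zs p).
Proof. by case: hs => mY mX _; exact: measurable_fun_pair. Qed.

Let upd phi i psi : I -> X * Y -> \bar R := fun j => if j == i then psi else phi j.

(** With the other factors frozen, factor [i] is integrated against the Dirac masses at [Zs i w],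
    mixed with the product of the remaining factors as weight. *)
Let LHS_rep i phi : (forall j, nnm (phi j)) ->
  exists m : {measure set (X * Y) -> \bar R},
    forall psi, nnm psi -> lhs (upd phi i psi) = \int[m]_z psi z.
Proof.
move=> nphi; pose V w := \prod_(p | p != i) phi p (Zs p w).
have V0 w : 0 <= V w by apply: prode_ge0 => p _; exact: (nphi p).1.
have mV : measurable_fun setT V.
  by apply: emeasurable_prod => p _; apply: measurableT_comp => //; exact: (nphi p).2.
pose K w : {measure set (X * Y) -> \bar R} := \d_(Zs i w).
have mK U : measurable U -> measurable_fun setT (K ^~ U).
  move=> mU; rewrite (_ : K ^~ U = EFin \o (fun w => \1_U (Zs i w)))//.
  apply/measurable_EFinP; apply: (measurableT_comp _ (mZs i)).
  exact: measurable_indic.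
exists (mixture P' V0 mV mK) => psi [psi0 mpsi].
rewrite integral_mixture//; apply: eq_integral => w _.
rewrite integral_dirac// diracT mul1e (bigD1 i)//= /upd eqxx muleC.
by congr (_ * _); apply: eq_bigr => p /negbTE ->.
Qed.

(** Here the measures [kpair kappa (Yv w)] are mixed. The weight collects the other averages of
    block [k0] and the constant [c] contributed by the other blocks. *)
Let RHS_rep i phi : (forall j, nnm (phi j)) ->
  exists m : {measure set (X * Y) -> \bar R},
    forall psi, nnm psi -> rhs (upd phi i psi) = \int[m]_z psi z.
Proof.
move=> nphi; case: i => k0 l0.
have kphi0 j w : 0 <= kavg kappa (phi j) (Yv w).
  by apply: kavg_ge0; exact: (nphi j).1.
have mkphi j : measurable_fun setT (fun w => kavg kappa (phi j) (Yv w)).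
  apply: (measurableT_comp (f := kavg kappa (phi j))) => //.
  by apply: measurable_kavg; [exact: (nphi j).1|exact: (nphi j).2].
pose c := \prod_(k < M | k != k0) \int[P]_w \prod_(l < N) kavg kappa (phi (k, l)) (Yv w).
have c0 : 0 <= c.
  by apply: prode_ge0 => k _; apply: integral_ge0 => w _; exact: prode_ge0.
pose V w := c * \prod_(l < N | l != l0) kavg kappa (phi (k0, l)) (Yv w).
have V0 w : 0 <= V w by apply: mule_ge0 => //; exact: prode_ge0.
have mV : measurable_fun setT V.
  by apply: measurable_funeM; exact: emeasurable_prod.
pose K w : {measure set (X * Y) -> \bar R} := kpair kappa (Yv w).
have mK U : measurable U -> measurable_fun setT (K ^~ U).
  move=> mU; apply: (measurableT_comp (f := (kpair kappa) ^~ U)) => //.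
  exact: measurable_kpair.
exists (mixture P V0 mV mK) => psi [psi0 mpsi].
rewrite integral_mixture// /rhs (bigD1 k0)//= muleC.
have -> : \prod_(k < M | k != k0)
    \int[P]_w \prod_(l < N) kavg kappa (upd phi (k0, l0) psi (k, l)) (Yv w) = c.
  apply: eq_bigr => k kk0; apply: eq_integral => w _; apply: eq_bigr => l _.
  by rewrite /upd xpair_eqE (negbTE kk0).
rewrite -ge0_integralZl//; last 2 first.
- apply: emeasurable_prod => l _; rewrite /upd; case: ifP => // _.
  apply: (measurableT_comp (f := kavg kappa psi)) => //.
  exact: measurable_kavg.
- move=> w _; apply: prode_ge0 => l _; rewrite /upd; case: ifP => // _.
  exact: kavg_ge0.
apply: eq_integral => w _; rewrite integral_kpair// /V -muleA; congr (_ * _).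
rewrite (bigD1 l0)//= /upd eqxx muleC; congr (_ * _).
by apply: eq_bigr => l /negbTE ll0; rewrite xpair_eqE ll0 andbF.
Qed.

Let indicators : set (X * Y -> \bar R) :=
  [set (fun z => (\1_C z)%:E) | C in measurable].

Let rect_indicators : set (X * Y -> \bar R) :=
  [set (fun z => (\1_(A `*` B) z)%:E) | A in measurable & B in measurable].

Let indicators_nnm : indicators `<=` nnm.
Proof.
move=> _ [C mC <-]; split => [z|]; first by rewrite lee_fin.
exact/measurable_EFinP.
Qed.

(** A product of indicators is the indicator of the intersection, so for rectangles the identity is
    the defining property of [hier_sample]. *)
Let base phi : (forall j, rect_indicators (phi j)) -> lhs phi = rhs phi.
Proof.
move=> rphi; case: hs => mY mX h.
have /choice[AB hAB] j : exists AB : set X * set Y, [/\ measurable AB.1,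
    measurable AB.2 & phi j = (fun z => (\1_(AB.1 `*` AB.2) z)%:E)].
  by have [A mA [B mB <-]] := rphi j; exists (A, B).
pose A k l := (AB (k, l)).1; pose B k l := (AB (k, l)).2.
have mA k l : measurable (A k l) by have [] := hAB (k, l).
have mB k l : measurable (B k l) by have [] := hAB (k, l).
have phiE k l : phi (k, l) = (fun z => (\1_(A k l `*` B k l) z)%:E).
  by have [] := hAB (k, l).
have prod_indic (J : finType) T (C : J -> set T) (t : T) :
    \prod_(j : J) (\1_(C j) t)%:E = (\1_(\bigcap_(j in [set: J]) C j) t)%:E :> \bar R.
  have [tC|tC] := pselect ((\bigcap_(j in [set: J]) C j) t).
    rewrite [in RHS]indicE mem_set// big1// => j _.
    by rewrite indicE mem_set//; exact: tC.
  rewrite [in RHS]indicE memNset//.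
  have [j ntj] : exists j, ~ C j t.
    by apply/existsNP => tC'; apply: tC => j _; exact: tC'.
  by rewrite (bigD1 j)//= indicE memNset// mul0e.
(* [hier_sample] takes one subset of [Y] per block, while the rectangles bring one for each [l]. *)
pose BB k := \bigcap_(l in [set: 'I_N]) B k l.
have mBB k : measurable (BB k) by apply: fin_bigcap_measurable => // l _.
transitivity (P' (\bigcap_(k in [set: 'I_M]) (Ys k @^-1` BB k `&`
    \bigcap_(l in [set: 'I_N]) Xs k l @^-1` A k l))).
  rewrite /lhs.
  have -> : (fun w => \prod_(p : I) phi p (Zs p w)) = (fun w =>
      (\1_(\bigcap_(p in [set: I]) (Zs p @^-1` (A p.1 p.2 `*` B p.1 p.2))) w)%:E).
    apply/funext => w; rewrite -prod_indic; apply: eq_bigr => -[k l] _.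
    by rewrite phiE.
  rewrite integral_indic//; last first.
    apply: fin_bigcap_measurable; [exact: finite_finset|move=> p _].
    by rewrite -[X in measurable X]setTI; apply: mZs => //; exact: measurableX.
  rewrite setIT; congr (P' _); apply/seteqP; split => w h' /=.
    move=> k _; split; first by move=> l _; have [] := h' (k, l) Logic.I.
    by move=> l _; have [] := h' (k, l) Logic.I.
  by move=> [k l] _; have [hB hA] := h' k Logic.I; split; [exact: hA|exact: hB].
rewrite h//; apply: eq_bigr => k _.
rewrite integral_mkcond; apply: eq_integral => w _.
rewrite patchE.
under [RHS]eq_bigr do rewrite phiE kavg_rect//.
rewrite big_split/= prod_indic indicE.
have -> : (w \in Yv @^-1` BB k) = (Yv w \in BB k) by exact/idP/idP.
by case: ifP => _; rewrite ?mul1e ?mul0e.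
Qed.

(** Blocks are independent, and inside a block the entries are independent given [Ys k]. The
    identity is extended from rectangles to measurable sets, then to nonnegative functions, one
    factor at a time: in a single factor each side is an integral against a measure, so it suffices
    that the two measures agree. *)
Lemma hier_sample_prod phi :
  (forall p z, 0 <= phi p z) -> (forall p, measurable_fun setT (phi p)) ->
  \int[P']_w \prod_(p : 'I_M * 'I_N) phi p (Xs p.1 p.2 w, Ys p.1 w) =
  \prod_(k < M) \int[P]_w \prod_(l < N) kavg kappa (phi (k, l)) (Yv w).
Proof.
move=> phi0 mphi.
apply: (@finite_family_ext I _ indicators nnm (fun phi => lhs phi = rhs phi)) => //.
- move=> i f nf; have [m1 Hm1] := LHS_rep i nf; have [m2 Hm2] := RHS_rep i nf.
  move=> indE psi npsi.
  have m12 C : measurable C -> m1 C = m2 C.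
    move=> mC; have Ci : indicators (fun z => (\1_C z)%:E) by exists C.
    have := indE _ Ci; rewrite [lhs _]Hm1 ?[rhs _]Hm2; try exact: indicators_nnm.
    by rewrite !integral_indic// !setIT.
  rewrite [lhs _]Hm1// [rhs _]Hm2//.
  by apply: eq_measure_integral => C mC _; exact: m12.
(* From rectangles to all measurable sets, by uniqueness of finite measures. *)
- apply: (@finite_family_ext I _ rect_indicators indicators
    (fun phi => lhs phi = rhs phi)) => //.
  + by move=> _ [A mA [B mB <-]]; exists (A `*` B) => //; exact: measurableX.
  + move=> i f indf; have nf j : nnm (f j) by exact: indicators_nnm.
    have [m1 Hm1] := LHS_rep i nf; have [m2 Hm2] := RHS_rep i nf.
    have m1E C : measurable C -> m1 C = lhs (upd f i (fun z => (\1_C z)%:E)).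
      move=> mC; rewrite Hm1; last by apply: indicators_nnm; exists C.
      by rewrite integral_indic// setIT.
    have m2E C : measurable C -> m2 C = rhs (upd f i (fun z => (\1_C z)%:E)).
      move=> mC; rewrite Hm2; last by apply: indicators_nnm; exists C.
      by rewrite integral_indic// setIT.
    move=> rE psi [C mC <-]; rewrite -[lhs _]m1E// -[rhs _]m2E//.
    apply: measure_eq_rectangles => //.
    (* The total mass of [m1] is the [P']-integral of a product of indicators, hence at most 1. *)
    * rewrite m1E// /lhs; apply: (@le_lt_trans _ _ (\int[P']_w cst 1 w)).
        have ind_upd p : indicators (upd f i (fun z => (\1_setT z)%:E) p).
          by rewrite /upd; case: ifP => // _; exists setT.
        have nupd p := indicators_nnm (ind_upd p).
        apply: ge0_le_integral => //.
        - by move=> w _; apply: prode_ge0 => p _; exact: (nupd p).1.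
        - apply: emeasurable_prod => p _; apply: measurableT_comp => //.
          exact: (nupd p).2.
        - move=> w _; suff /andP[] : 0 <= \prod_(p : I)
              upd f i (fun z => (\1_setT z)%:E) p (Zs p w) <= 1 by [].
          elim/big_ind : _ => [|x y /andP[x0 x1] /andP[y0 y1]|p _].
          + by rewrite lexx lee01.
          + by rewrite mule_ge0//= -[leRHS]mule1 lee_pmul.
          + have [D _ <-] := ind_upd p.
            by rewrite !lee_fin indicE ler0n lern1 leq_b1.
      by rewrite integral_cst//= probability_setT mule1 ltry.
    * move=> A B mA mB; rewrite m1E ?m2E; try exact: measurableX.
      by apply: rE; exists A => //; exists B.
Qed.
End hierarchical_product.

(** * Disintegration, marginals and Chernoff bounds for hierarchical samples *)

Section hierarchical_tail.
Local Open Scope ereal_scope.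
Context dO dO' d1 d2 (Om : measurableType dO) (Om' : measurableType dO')
  (X : measurableType d1) (Y : measurableType d2) (R : realType).
Variables (P : probability Om R) (Xv : Om -> X) (Yv : Om -> Y)
  (kappa : R.-pker Y ~> X).
Hypotheses (mXv : measurable_fun setT Xv) (mYv : measurable_fun setT Yv).

Lemma kavg1 y : kavg kappa (cst 1) y = 1.
Proof. by rewrite /kavg integral_cst// mul1e prob_kernel. Qed.

Section disintegration.
Hypothesis rcd : reg_cond_distr P Xv Yv kappa.

(* Disintegration is thereby the case [M = N = 1] of [hier_sample_prod]. *)
Lemma reg_cond_distr_hier_sample :
  hier_sample P Yv kappa P (fun _ : 'I_1 => Yv) (fun _ _ : 'I_1 => Xv).
Proof.
split => // B A mB mA; rewrite big_ord1.
under eq_integral do rewrite big_ord1.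
rewrite -rcd//; congr (P _); apply/seteqP; split => w /=.
  by move=> /(_ ord0 Logic.I)[Bw Aw]; split => //; exact: (Aw ord0).
by move=> [Aw Bw] k _; rewrite ord1; split => // l _; rewrite ord1.
Qed.

Lemma integral_reg_cond_distr (psi : X * Y -> \bar R) :
  (forall z, 0 <= psi z) -> measurable_fun setT psi ->
  \int[P]_w psi (Xv w, Yv w) = \int[P]_w kavg kappa psi (Yv w).
Proof.
move=> psi0 mpsi.
have := hier_sample_prod mYv reg_cond_distr_hier_sample (fun _ => psi0) (fun _ => mpsi).
rewrite big_ord1 (_ : (fun w => \prod_(p : 'I_1 * 'I_1) psi (Xv w, Yv w)) =
  (fun w => psi (Xv w, Yv w))).
  by move=> ->; apply: eq_integral => w _; rewrite big_ord1.
apply/funext => w; rewrite (bigD1 (ord0, ord0))//= big1 ?mule1// => -[i j].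
by rewrite !ord1 eqxx.
Qed.

End disintegration.

Variables (P' : probability Om' R) (M N : nat).
Variables (Ys : 'I_M -> Om' -> Y) (Xs : 'I_M -> 'I_N -> Om' -> X).
Hypothesis hs : hier_sample P Yv kappa P' Ys Xs.

Let measurable_Zs k l : measurable_fun setT (fun w => (Xs k l w, Ys k w)).
Proof. by case: hs => mY mX _; exact: measurable_fun_pair. Qed.

(** The product formula with the indicator of [C] at [(k, l)] and 1 elsewhere; the constant factors
    average to 1 since [kappa] is a probability kernel. It carries null sets of the law of
    [(Xv, Yv)] over to the sample. *)
Lemma hier_sample_marginal (C : set (X * Y)) k l : measurable C ->
  reg_cond_distr P Xv Yv kappa ->
  P' ((fun w => (Xs k l w, Ys k w)) @^-1` C) =
  P ((fun w => (Xv w, Yv w)) @^-1` C).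
Proof.
move=> mC rcd.
have mind : measurable_fun setT (fun z : X * Y => (\1_C z)%:E : \bar R).
  exact/measurable_EFinP.
pose phi p (z : X * Y) : \bar R := if p == (k, l) then (\1_C z)%:E else 1.
have phi0 p z : 0 <= phi p z by rewrite /phi; case: ifP.
have mphi p : measurable_fun setT (phi p).
  by rewrite /phi; have [_|_] := eqVneq p (k, l).
have := hier_sample_prod mYv hs phi0 mphi.
rewrite (_ : (fun w => _) = (fun w =>
    (\1_((fun w => (Xs k l w, Ys k w)) @^-1` C) w)%:E)); last first.
  apply/funext => w; rewrite (bigD1 (k, l))//= big1 ?mule1 ?/phi ?eqxx//.
  by move=> p /negbTE ->.
rewrite integral_indic//; last first.
  by rewrite -[X in measurable X]setTI; exact: measurable_Zs.
rewrite setIT => ->.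
rewrite (bigD1 k)//= [X in _ * X]big1 ?mule1; last first.
  move=> k' k'k; under eq_integral.
    move=> w _; rewrite big1; first over.
    move=> l' _; rewrite (_ : phi (k', l') = cst 1) ?kavg1//.
    by apply/funext => z; rewrite /phi xpair_eqE (negbTE k'k).
  by rewrite integral_cst//= probability_setT mule1.
transitivity (\int[P]_w kavg kappa (fun z => (\1_C z)%:E) (Yv w)).
  apply: eq_integral => w _; rewrite (bigD1 l)//= big1 ?mule1.
    by rewrite /phi eqxx.
  move=> l' l'l; rewrite (_ : phi (k, l') = cst 1) ?kavg1//.
  by apply/funext => z; rewrite /phi xpair_eqE (negbTE l'l) andbF.
rewrite -integral_reg_cond_distr//.
rewrite (_ : (fun w => _) = (fun w =>
    (\1_((fun w => (Xv w, Yv w)) @^-1` C) w)%:E))//.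
rewrite integral_indic ?setIT//.
by rewrite -[X in measurable X]setTI; exact: measurable_fun_pair.
Qed.

(** Inside a block the [N] conditional bounds at [s] multiply, leaving the exponential of [c] at the
    parameter [N * s], where the second bound applies. The [M] blocks then multiply. *)
Lemma hier_sample_mgf_le (h : X -> Y -> R) (c : Y -> R) (Delta b1 b2 s : R) :
  measurable_fun setT (fun p : X * Y => h p.1 p.2) ->
  measurable_fun setT c ->
  {ae P, forall w, \int[kappa (Yv w)]_x (expR (s * h x (Yv w)))%:E
    <= (expR (c (Yv w) * s + b1 ^+ 2 * s ^+ 2 / 2))%:E} ->
  \int[P]_w (expR ((N%:R * s) * c (Yv w)))%:E
    <= (expR (Delta * (N%:R * s) + b2 ^+ 2 * (N%:R * s) ^+ 2 / 2))%:E ->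
  \int[P']_w (expR (s * \sum_(k < M) \sum_(l < N) h (Xs k l w) (Ys k w)))%:E
    <= (expR (M%:R * (Delta * (N%:R * s) + N%:R * (b1 ^+ 2 * s ^+ 2 / 2)
          + b2 ^+ 2 * (N%:R * s) ^+ 2 / 2)))%:E.
Proof.
move=> mh mc h1 h2.
pose phi (p : 'I_M * 'I_N) (z : X * Y) : \bar R := (expR (s * h z.1 z.2))%:E.
have phi0 p z : 0 <= phi p z by rewrite lee_fin expR_ge0.
have mphi p : measurable_fun setT (phi p).
  apply/measurable_EFinP; apply: measurableT_comp => //.
  exact: measurable_funM.
have := hier_sample_prod mYv hs phi0 mphi.
rewrite (_ : (fun w => \prod_p _) = (fun w =>
   (expR (s * \sum_(k < M) \sum_(l < N) h (Xs k l w) (Ys k w)))%:E)); last first.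
  apply/funext => w; rewrite pair_big/= mulr_sumr expR_sum -prodEFin//.
move=> ->.
rewrite expRM_natl -[M in (_ ^+ M)%R]card_ord -prodr_const -prodEFin.
apply: lee_prod_nng => k; apply/andP; split.
  apply: integral_ge0 => w _; apply: prode_ge0 => l _; exact: kavg_ge0.
apply: (@le_trans _ _ (\int[P]_w ((expR (N%:R * (b1 ^+ 2 * s ^+ 2 / 2)))%:E *
    (expR ((N%:R * s) * c (Yv w)))%:E))); last first.
  rewrite ge0_integralZl//.
  - apply: (@le_trans _ _ ((expR (N%:R * (b1 ^+ 2 * s ^+ 2 / 2)))%:E *
      (expR (Delta * (N%:R * s) + b2 ^+ 2 * (N%:R * s) ^+ 2 / 2))%:E)).
      by apply: lee_wpmul2l => //; rewrite lee_fin expR_ge0.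
    by rewrite -EFinM -expRD lee_fin ler_expR; lra.
  - apply/measurable_EFinP; apply: measurableT_comp => //.
    by apply: measurable_funM => //; exact: measurableT_comp.
have mc' : measurable_fun setT (fun w => (expR (N%:R * s * c (Yv w)))%:E : \bar R).
  apply/measurable_EFinP; apply: measurableT_comp => //.
  by apply: measurable_funM => //; exact: measurableT_comp.
apply: ae_ge0_le_integral => //.
- by move=> w _; apply: prode_ge0 => l _; exact: kavg_ge0.
- apply: emeasurable_prod => l _.
  by apply: (measurableT_comp (f := kavg kappa (phi (k, l)))) => //; exact: measurable_kavg.
- exact: measurable_funeM.
apply: filterS h1 => w h1 _.
rewrite -EFinM -expRD (_ : (_ + _)%R =
  (N%:R * (c (Yv w) * s + b1 ^+ 2 * s ^+ 2 / 2))%R); last by lra.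
rewrite expRM_natl -[N in (_ ^+ N)%R]card_ord -prodr_const -prodEFin.
apply: lee_prod_nng => l.
by rewrite kavg_ge0//=.
Qed.

(** Markov's inequality applied to the exponential of [s] times the double sum. It serves twice: for
    increments of [g] and for [L]. *)
Lemma hier_sample_tail (h : X -> Y -> R) (c : Y -> R) (Delta b1 b2 eta : R) :
  (0 < M)%N -> (0 < N)%N -> (0 < b1)%R -> (0 < b2)%R -> (0 < eta)%R ->
  measurable_fun setT (fun p : X * Y => h p.1 p.2) ->
  measurable_fun setT c ->
  (forall s : R, {ae P, forall w, \int[kappa (Yv w)]_x (expR (s * h x (Yv w)))%:E
    <= (expR (c (Yv w) * s + b1 ^+ 2 * s ^+ 2 / 2))%:E}) ->
  (forall u : R, \int[P]_w (expR (u * c (Yv w)))%:E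
    <= (expR (Delta * u + b2 ^+ 2 * u ^+ 2 / 2))%:E) ->
  let E := [set w | (Delta + eta <=
    (M * N)%:R^-1 * \sum_(k < M) \sum_(l < N) h (Xs k l w) (Ys k w))%R] in
  measurable E /\
  P' E <= (expR (- (M%:R * eta ^+ 2) / (2 * (b1 ^+ 2 / N%:R + b2 ^+ 2))))%:E.
Proof.
move=> M0 N0 b10 b20 eta0 mh mc h1 h2 E.
pose F w := (\sum_(k < M) \sum_(l < N) h (Xs k l w) (Ys k w))%R.
have mF : measurable_fun setT F.
  apply: measurable_sum => k; apply: measurable_sum => l.
  exact: (measurableT_comp mh (measurable_Zs k l)).
have mE : measurable E.
  rewrite -[E]setTI; apply: measurable_fun_le => //.
  by apply: measurable_funM.
split => //.
(* The variance proxy of one block mean: averaging over [N] entries reduces the conditional part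
   [b1] only. *)
pose B : R := (b1 ^+ 2 / N%:R + b2 ^+ 2)%R.
have B0 : (0 < B)%R by rewrite addr_gt0 ?divr_gt0 ?exprn_gt0 ?ltr0n.
(* the minimiser over [s] of the Chernoff exponent *)
pose s : R := (eta / B / N%:R)%R.
have s0 : (0 < s)%R by rewrite !divr_gt0 ?ltr0n.
have MN0 : (0 < (M * N)%:R :> R)%R by rewrite ltr0n muln_gt0 M0.
(* Chosen so that [expR a * expR (s * F w)] is at least 1 on [E]. *)
pose a : R := (- (s * ((M * N)%:R * (Delta + eta))))%R.
apply: (@le_trans _ _ (\int[P']_w ((expR a)%:E * (expR (s * F w))%:E))).
  rewrite -[X in P' X]setIT -integral_indic//.
  apply: ge0_le_integral => //.
  - exact/measurable_EFinP.
  - apply: measurable_funeM; apply/measurable_EFinP; apply: measurableT_comp => //.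
    exact: measurable_funM.
  - move=> w _; rewrite -EFinM -expRD lee_fin indicE.
    have [wE|_] := boolP (w \in E); last by rewrite expR_ge0.
    rewrite -[leLHS]expR0 ler_expR /a addrC subr_ge0 ler_pM2l//.
    by move/set_mem : wE; rewrite /E /= -/(F w) ler_pdivlMl.
rewrite ge0_integralZl//; last first.
  apply/measurable_EFinP; apply: measurableT_comp => //; exact: measurable_funM.
apply: le_trans.
  apply: lee_wpmul2l; first by rewrite lee_fin expR_ge0.
  exact: (hier_sample_mgf_le mh mc (h1 s) (h2 _)).
rewrite -EFinM -expRD lee_fin ler_expR.
have N0' : (N%:R : R) != 0%R by rewrite pnatr_eq0 -lt0n.
have sN : (N%:R * s = eta / B)%R by rewrite /s mulrC divfK.
rewrite sN /a /s natrM.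
suff -> : (- (M%:R * eta ^+ 2) / (2 * B) =
  - (eta / B / N%:R * (M%:R * N%:R * (Delta + eta))) + M%:R *
  (Delta * (eta / B) + N%:R * (b1 ^+ 2 * (eta / B / N%:R) ^+ 2 / 2) +
   b2 ^+ 2 * (eta / B) ^+ 2 / 2))%R by [].
have -> : (b2 ^+ 2 = B - b1 ^+ 2 / N%:R)%R by rewrite /B; ring.
by field; rewrite N0' gt_eqF.
Qed.
End hierarchical_tail.

(** * Hoeffding's lemma *)

Section hoeffding.
Context (R : realType).
Implicit Types l s v : R.

(** Compares the Taylor coefficients of the hyperbolic cosine with those of [expR (x ^+ 2 / 2)]. *)
Lemma fact_double_ge n : (2 ^ n * n`! <= (n.*2)`!)%N.
Proof.
elim: n => // n ih; rewrite doubleS !factS expnS.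
have -> : (2 * 2 ^ n * (n.+1 * n`!) = (2 * n.+1) * (2 ^ n * n`!))%N.
  by rewrite !mulnA; congr muln; rewrite -!mulnA; congr muln; rewrite mulnC.
rewrite leq_mul//; first by rewrite -doubleS -mul2n.
by rewrite (leq_trans ih)// leq_pmull.
Qed.

(** In the sum of the two exponential series the odd terms cancel, and the even ones are dominated
    term by term. *)
Lemma expR_add_expRN_le (x : R) : expR x + expR (- x) <= 2 * expR (x ^+ 2 / 2).
Proof.
(* The left partial sums run to [n.*2], so that each step adds one even and one odd term. *)
have part n : series (exp_coeff x) n.*2 + series (exp_coeff (- x)) n.*2 <=
    2 * series (exp_coeff (x ^+ 2 / 2)) n.
  rewrite /series /=; elim: n => [|n ih]; first by rewrite !big_geq// addr0 mulr0.
  rewrite doubleS !big_nat_recr//= [in X in _ <= X]mulrDr.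
  have -> : exp_coeff (- x) n.*2.+1 = - exp_coeff x n.*2.+1.
    by rewrite /exp_coeff /= exprNn -signr_odd /= odd_double expr1 mulN1r mulNr.
  have -> : exp_coeff (- x) n.*2 = exp_coeff x n.*2.
    by rewrite /exp_coeff /= exprNn -signr_odd odd_double expr0 mul1r.
  suff h : exp_coeff x n.*2 <= exp_coeff (x ^+ 2 / 2) n by lra.
  rewrite /exp_coeff /= expr_div_n -exprM mul2n -mulrA -invfM.
  apply: ler_wpM2l; first by rewrite -mul2n exprM exprn_ge0// sqr_ge0.
  rewrite -natrX -natrM lef_pV2 ?posrE ?ltr0n ?muln_gt0 ?expn_gt0 ?fact_gt0//.
  by rewrite ler_nat fact_double_ge.
have cv (y : R) : series (exp_coeff y) n @[n --> \oo] --> expR y.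
  exact: is_cvg_series_exp_coeff.
have cv2 (y : R) : series (exp_coeff y) n.*2 @[n --> \oo] --> expR y.
  move=> A /cv[N _ NA]; exists N => // n /= Nn; apply: NA => /=.
  by rewrite (leq_trans Nn)// -addnn leq_addr.
have cl := cvgD (cv2 x) (cv2 (- x)).
have cr := @cvgM _ _ _ _ (cst (2 : R)) _ _ _ (cvg_cst _) (cv (x ^+ 2 / 2)).
by apply: (ler_cvg_to (cl _) (cr _ _)); exact: nearW.
Qed.

(** By convexity the exponential lies below its chord between [- (s * l)] and [s * l]; the weight of
    the left end is [(l - v) / (2 * l)]. *)
Lemma expR_chord l s v : 0 < l -> `|v| <= l ->
  expR (s * v) <= (expR (s * l) + expR (- (s * l))) / 2
     + (expR (s * l) - expR (- (s * l))) / (2 * l) * v.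
Proof.
move=> l0; rewrite ler_norml => /andP[v1 v2].
have t01 : 0 <= (l - v) / (2 * l) <= 1.
  by rewrite divr_ge0 ?subr_ge0 ?mulr_ge0 ?(ltW l0)//= ler_pdivrMr ?mulr_gt0//; lra.
have [/andP[t0 t1] lN0] := (t01, lt0r_neq0 l0).
have := @convex_expR R (Itv01 t0 t1) (- (s * l)) (s * l).
rewrite !convRE /= /unstable.onem.
have -> : (l - v) / (2 * l) * - (s * l) + (1 - (l - v) / (2 * l)) * (s * l) = s * v.
  by field; rewrite lN0.
by move=> /le_trans; apply; rewrite le_eqVlt; apply/orP; left; apply/eqP; field.
Qed.

(** The exponential is replaced by its chord, whose integral depends on the mean alone; the
    resulting hyperbolic cosine is bounded by [expR_add_expRN_le]. Asking only for total mass 1 lets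
    the lemma apply to [P] and to the values of [kappa]. *)
Lemma hoeffding_mgf_le d (T : measurableType d)
    (m : {measure set T -> \bar R}) (f : T -> R) l s :
  m setT = 1%E -> 0 < l -> measurable_fun setT f ->
  let mean := fine (\int[m]_x (f x)%:E)%E in
  {ae m, forall x, `|f x - mean| <= l} ->
  (\int[m]_x (expR (s * f x))%:E <= (expR (mean * s + l ^+ 2 * s ^+ 2 / 2))%:E)%E.
Proof.
move=> m1 l0 mf mean hb.
have intcst (c : R) : m.-integrable setT (fun=> c%:E).
  apply/integrableP; split => //.
  rewrite (_ : (fun x => _) = cst `|c|%:E)// integral_cst//= m1 mule1 ltry//.
(* Almost sure boundedness makes [f] integrable, so that [fine] in [mean] loses nothing. *)
have fint : m.-integrable setT (EFin \o f).
  apply/integrableP; split; first exact/measurable_EFinP.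
  apply: (@le_lt_trans _ _ (\int[m]_x (cst (`|mean| + l)%:E x))%E).
    apply: ae_ge0_le_integral => //.
    - by apply: measurableT_comp => //; exact/measurable_EFinP.
    - by move=> x _; rewrite lee_fin addr_ge0// ltW.
    - apply: filterS hb => x hx _ /=; rewrite lee_fin.
      by rewrite -(subrK mean (f x)) addrC (le_trans (ler_normD _ _))// lerD2l.
  by rewrite integral_cst//= m1 mule1 ltry.
have meanE : (\int[m]_x (f x)%:E = mean%:E)%E.
  by rewrite fineK//; exact: integrable_fin_num.
pose A : R := (expR (s * l) + expR (- (s * l))) / 2.
pose B : R := (expR (s * l) - expR (- (s * l))) / (2 * l).
pose chord x := expR (s * mean) * (A + B * (f x - mean)).
have mchord : measurable_fun setT chord.
  apply: measurable_funM => //; apply: measurable_funD => //.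
  by apply: measurable_funM => //; exact: measurable_funB.
(* The centred linear term integrates to 0. *)
have chordE : (\int[m]_x (chord x)%:E = (expR (s * mean) * A)%:E)%E.
  pose a : R := expR (s * mean) * (A - B * mean).
  pose b : R := expR (s * mean) * B.
  rewrite (_ : (fun x => _) = (fun x => a%:E + b%:E * (f x)%:E)%E); last first.
    by apply/funext => x; rewrite -EFinM -EFinD; congr EFin; rewrite /chord /a /b; ring.
  rewrite integralD//=; last exact: integrableZl.
  rewrite integralZl// meanE integral_cst//= m1 mule1 -EFinM -EFinD; congr EFin.
  by rewrite /a /b; ring.
have hchord x : `|f x - mean| <= l -> expR (s * f x) <= chord x.
  move=> hx; rewrite /chord -[X in s * X](subrK mean) addrC mulrDr expRD.
  by apply: ler_wpM2l; [exact: expR_ge0|exact: expR_chord].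
(* The chord is known to be nonnegative only almost everywhere, while the comparison of integrals
   wants a bound nonnegative everywhere. *)
apply: (@le_trans _ _ (\int[m]_x (Num.max (chord x) 0)%:E)%E).
  apply: ae_ge0_le_integral => //.
  - apply/measurable_EFinP; apply: measurableT_comp => //; exact: measurable_funM.
  - by move=> x _; rewrite lee_fin le_max lexx orbT.
  - by apply/measurable_EFinP; exact: measurable_maxr.
  - by apply: filterS hb => x hx _; rewrite lee_fin le_max hchord.
rewrite (@ae_eq_integral _ _ _ m setT (EFin \o chord))//; last first.
- apply: filterS hb => x hx _ /=; congr EFin; apply/max_idPl.
  exact: le_trans (expR_ge0 _) (hchord _ hx).
- exact/measurable_EFinP.
- by apply/measurable_EFinP; exact: measurable_maxr.
rewrite chordE lee_fin expRD (mulrC mean).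
apply: ler_wpM2l; first exact: expR_ge0.
have := expR_add_expRN_le (s * l); rewrite /A exprMn (mulrC (l ^+ 2)) => h.
by lra.
Qed.

End hoeffding.

(** * Conditional expectations *)

Section conditional_expectation.
Local Open Scope ereal_scope.
Context dO d1 d2 (Om : measurableType dO)
  (X : measurableType d1) (Y : measurableType d2) (R : realType).
Variables (P : probability Om R) (Xv : Om -> X) (Yv : Om -> Y)
  (kappa : R.-pker Y ~> X).
Hypotheses (mXv : measurable_fun setT Xv) (mYv : measurable_fun setT Yv).

(** Positive and negative parts are averaged separately, since [measurable_kavg] concerns
    nonnegative functions. *)
Lemma measurable_condE (f : X -> Y -> R) :
  measurable_fun setT (fun p : X * Y => f p.1 p.2) ->
  measurable_fun setT (condE kappa f).
Proof.
move=> mf; pose F (p : X * Y) := (f p.1 p.2)%:E.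
have mF : measurable_fun setT F by exact/measurable_EFinP.
apply: (measurableT_comp (f := fine)); first exact: fine_measurable.
have mp : measurable_fun setT (kavg kappa F^\+).
  by apply: measurable_kavg => [z|]; [exact: funepos_ge0|exact: measurable_funepos].
have mn : measurable_fun setT (kavg kappa F^\-).
  by apply: measurable_kavg => [z|]; [exact: funeneg_ge0|exact: measurable_funeneg].
rewrite (_ : (fun y => _) = kavg kappa F^\+ \- kavg kappa F^\-).
  exact: emeasurable_funB.
apply/funext => y; rewrite integralE.
by congr (_ - _); apply: eq_integral => x _; rewrite ?funeposE ?funenegE.
Qed.

Hypothesis rcd : reg_cond_distr P Xv Yv kappa.

(** By disintegration the [kappa (Yv w)]-masses of the sections of [C] integrate to 0, so almost all
    of them vanish. Bounds holding almost surely for [(Xv, Yv)] thus hold under almost every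
    conditional law. *)
Lemma ae_kernel_null (C : set (X * Y)) : measurable C ->
  P ((fun w => (Xv w, Yv w)) @^-1` C) = 0 ->
  {ae P, forall w, (kappa (Yv w)).-negligible [set x | C (x, Yv w)]}.
Proof.
move=> mC PC0; pose psi (z : X * Y) : \bar R := (\1_C z)%:E.
have mpsi : measurable_fun setT psi by exact/measurable_EFinP.
have psi0 z : 0 <= psi z by rewrite lee_fin.
have mk : measurable_fun setT (fun w => kavg kappa psi (Yv w)).
  by apply: (measurableT_comp (f := kavg kappa psi)) => //; exact: measurable_kavg.
have : \int[P]_w kavg kappa psi (Yv w) = 0.
  rewrite -(integral_reg_cond_distr mXv mYv rcd)//.
  rewrite (_ : (fun w => _) = (fun w =>
    (\1_((fun w => (Xv w, Yv w)) @^-1` C) w)%:E))//.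
  rewrite integral_indic ?setIT//.
  by rewrite -[X in measurable X]setTI; exact: measurable_fun_pair.
rewrite (_ : (fun w => _) = (fun w => `|kavg kappa psi (Yv w)|)); last first.
  by apply/funext => w; rewrite gee0_abs//; exact: kavg_ge0.
move/ae_eq_integral_abs => /(_ measurableT mk); apply: filterS => w /(_ Logic.I) /= k0.
apply/negligibleP.
  rewrite -[X in measurable X]setTI.
  exact: (measurable_pairr (Yv w) measurableT mC).
by rewrite -k0 kavg_indic.
Qed.

Variables (L : X -> Y -> R) (Lbar l1 l2 : R).
Hypothesis mL : measurable_fun setT (fun p : X * Y => L p.1 p.2).
Hypothesis L0 : forall x y, (0 < L x y)%R.
Hypothesis intL : \int[P]_w (L (Xv w) (Yv w))%:E = Lbar%:E.
Hypotheses (l10 : (0 < l1)%R) (l20 : (0 < l2)%R).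
Hypothesis L1 :
  {ae P, forall w, (`|L (Xv w) (Yv w) - condE kappa L (Yv w)| <= l1)%R}.
Hypothesis L2 : {ae P, forall w, (`|condE kappa L (Yv w) - Lbar| <= l2)%R}.

(** Hoeffding's lemma under [kappa (Yv w)], where the mean of [L] is [condE kappa L (Yv w)] by
    definition. *)
Lemma condE_mgf_le s :
  {ae P, forall w, \int[kappa (Yv w)]_x (expR (s * L x (Yv w)))%:E
    <= (expR (condE kappa L (Yv w) * s + l1 ^+ 2 * s ^+ 2 / 2))%:E}.
Proof.
have mc := measurable_condE mL.
pose C := ~` [set z : X * Y | (`|L z.1 z.2 - condE kappa L z.2| <= l1)%R].
have mC : measurable C.
  apply: measurableC; rewrite -[X in measurable X]setTI.
  apply: measurable_fun_le => //.
  apply: measurableT_comp => //; apply: measurable_funB => //.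
  exact: measurableT_comp.
have PC : P ((fun w => (Xv w, Yv w)) @^-1` C) = 0.
  apply: measure_negligible.
    by rewrite -[X in measurable X]setTI; exact: measurable_fun_pair.
  exact: negligibleS L1.
apply: filterS (ae_kernel_null mC PC) => w negw.
apply: (hoeffding_mgf_le (m := kappa (Yv w)) (f := L ^~ (Yv w))) => //.
- exact: prob_kernel.
- exact: (measurableT_comp mL (measurable_pairr (Yv w))).
Qed.

(** The tower property. [condE] and [kavg] agree wherever the latter is finite, which is almost
    everywhere because its integral [Lbar] is finite. *)
Lemma mean_condE : \int[P]_w (condE kappa L (Yv w))%:E = Lbar%:E.
Proof.
pose psi (z : X * Y) : \bar R := (L z.1 z.2)%:E.
have mpsi : measurable_fun setT psi by exact/measurable_EFinP.
have psi0 z : 0 <= psi z by rewrite lee_fin ltW.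
have mk : measurable_fun setT (fun w => kavg kappa psi (Yv w)).
  by apply: (measurableT_comp (f := kavg kappa psi)) => //; exact: measurable_kavg.
have intk : \int[P]_w kavg kappa psi (Yv w) = Lbar%:E.
  by rewrite -(integral_reg_cond_distr mXv mYv rcd).
rewrite -intk; apply: ae_eq_integral => //.
  apply/measurable_EFinP; apply: measurableT_comp => //; exact: measurable_condE.
have ik : P.-integrable setT (fun w => kavg kappa psi (Yv w)).
  apply/integrableP; split => //.
  under eq_integral do rewrite gee0_abs ?kavg_ge0//.
  by rewrite intk ltry.
apply: filterS (integrable_ae measurableT ik) => w /(_ Logic.I) h _ /=.
by rewrite /condE -/(kavg kappa psi (Yv w)) fineK.
Qed.

Lemma mgf_condE_le u : \int[P]_w (expR (u * condE kappa L (Yv w)))%:E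
    <= (expR (Lbar * u + l2 ^+ 2 * u ^+ 2 / 2))%:E.
Proof.
have mc := measurableT_comp (measurable_condE mL) mYv.
have := @hoeffding_mgf_le _ _ _ P (condE kappa L \o Yv) l2 u (probability_setT P) l20 mc.
by rewrite /= mean_condE /=; exact.
Qed.

End conditional_expectation.

(** * Packings in Euclidean space *)

Section euclidean_norm.
Context (R : realType) (d : nat).
Implicit Types u v : 'rV[R]_d.

Lemma enorm_ge0 v : 0 <= enorm v. Proof. exact: sqrtr_ge0. Qed.

Lemma enormN v : enorm (- v) = enorm v.
Proof. by rewrite /enorm; congr Num.sqrt; apply: eq_bigr => i _; rewrite mxE sqrrN. Qed.

Lemma enormZ (a : R) v : enorm (a *: v) = `|a| * enorm v.
Proof.
rewrite /enorm -sqrtr_sqr -sqrtrM ?sqr_ge0//; congr Num.sqrt.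
by rewrite mulr_sumr; apply: eq_bigr => i _; rewrite mxE exprMn.
Qed.

Lemma enorm0 : enorm (0 : 'rV[R]_d) = 0.
Proof. by rewrite -(scale0r 0) enormZ normr0 mul0r. Qed.

Lemma enorm_sqr v : enorm v ^+ 2 = \sum_(i < d) v ord0 i ^+ 2.
Proof. by rewrite sqr_sqrtr// sumr_ge0// => i _; exact: sqr_ge0. Qed.

Lemma coord_le_enorm v i : `|v ord0 i| <= enorm v.
Proof.
rewrite -sqrtr_sqr ler_wsqrtr// (bigD1 i)//= lerDl sumr_ge0// => j _.
exact: sqr_ge0.
Qed.

Lemma enorm_le_sum v : enorm v <= \sum_(i < d) `|v ord0 i|.
Proof.
have s0 : 0 <= \sum_(i < d) `|v ord0 i| by exact: sumr_ge0.
rewrite -(ler_pXn2r (n := 2)) ?nnegrE ?enorm_ge0// enorm_sqr expr2 mulr_suml.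
apply: ler_sum => i _; rewrite -[leLHS]ger0_norm ?sqr_ge0// normrX expr2 ler_wpM2l//.
by rewrite (bigD1 i)//= lerDl sumr_ge0.
Qed.

(** Expands the nonnegative sum of the squares of [b * u i - a * v i], with [a] and [b] the two
    norms; a zero norm is treated apart. *)
Lemma cauchy_schwarz_sum u v :
  \sum_(i < d) u ord0 i * v ord0 i <= enorm u * enorm v.
Proof.
pose a := enorm u; pose b := enorm v.
have [a0|a0] := eqVneq a 0.
  have z i : u ord0 i = 0.
    by apply/eqP; rewrite -normr_le0 (le_trans (coord_le_enorm _ _))// -/a a0.
  by rewrite big1 ?mulr_ge0 ?enorm_ge0// => i _; rewrite z mul0r.
have [b0|b0] := eqVneq b 0.
  have z i : v ord0 i = 0.
    by apply/eqP; rewrite -normr_le0 (le_trans (coord_le_enorm _ _))// -/b b0.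
  by rewrite big1 ?mulr_ge0 ?enorm_ge0// => i _; rewrite z mulr0.
have ap : 0 < a by rewrite lt0r a0 enorm_ge0.
have bp : 0 < b by rewrite lt0r b0 enorm_ge0.
have : 0 <= \sum_(i < d) (b * u ord0 i - a * v ord0 i) ^+ 2.
  by apply: sumr_ge0 => i _; exact: sqr_ge0.
have -> : \sum_(i < d) (b * u ord0 i - a * v ord0 i) ^+ 2 =
    b ^+ 2 * \sum_(i < d) u ord0 i ^+ 2 + a ^+ 2 * \sum_(i < d) v ord0 i ^+ 2
    - 2 * a * b * \sum_(i < d) u ord0 i * v ord0 i.
  rewrite !mulr_sumr -big_split/= -sumrB; apply: eq_bigr => i _; ring.
rewrite -!enorm_sqr -/a -/b => h.
have : 0 <= 2 * a * b * (a * b - \sum_(i < d) u ord0 i * v ord0 i) by lra.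
by rewrite pmulr_rge0 ?subr_ge0// !mulr_gt0.
Qed.

Lemma enormD u v : enorm (u + v) <= enorm u + enorm v.
Proof.
rewrite -(ler_pXn2r (n := 2)) ?nnegrE ?enorm_ge0 ?addr_ge0 ?enorm_ge0//.
rewrite sqrrD !enorm_sqr.
have -> : \sum_(i < d) (u + v) ord0 i ^+ 2 = \sum_(i < d) u ord0 i ^+ 2 +
    (\sum_(i < d) u ord0 i * v ord0 i) *+ 2 + \sum_(i < d) v ord0 i ^+ 2.
  by rewrite -sumrMnl -!big_split/=; apply: eq_bigr => i _; rewrite mxE sqrrD.
by rewrite lerD2r lerD2l ler_wMn2r// cauchy_schwarz_sum.
Qed.

Lemma enormB_ge u v : enorm u - enorm v <= enorm (u - v).
Proof. by rewrite lerBlDr -[in leLHS](subrK v u) enormD. Qed.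

End euclidean_norm.

Section packing.
Context (R : realType) (d : nat).
Implicit Types (s c : seq 'rV[R]_d) (x y : 'rV[R]_d) (nu D q : R).

Definition separated nu s :=
  uniq s /\ {in s &, forall x y, x != y -> nu <= enorm (x - y)}.

(** With [q * nu = D + nu], distinct [x] move the translates of [c] at least [D + nu] apart, more
    than the diameter of [c] by [nu]. The summand [nu] in the diameter bound makes the invariant
    scale exactly by [q]. *)
Lemma separated_iter nu D c j : 0 < nu -> 0 <= D -> separated nu c ->
  {in c &, forall x y, enorm (x - y) <= D} ->
  exists2 s, size s = (size c ^ j)%N & separated nu s /\
    {in s &, forall x y, enorm (x - y) + nu <= (D / nu + 1) ^+ j * nu}.
Proof.
move=> nu0 D0 [uc sepc] diamc; set q := D / nu + 1.
have qnu : q * nu = D + nu by rewrite /q mulrDl mul1r divfK ?gt_eqF.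
have q0 : 0 <= q by rewrite addr_ge0 ?divr_ge0// ltW.
elim: j => [|j [s sizes [[us seps] diams]]].
  exists [:: 0] => //; split.
    by split => // x y; rewrite !inE => /eqP -> /eqP ->; rewrite eqxx.
  move=> x y; rewrite !inE => /eqP -> /eqP ->.
  by rewrite subr0 expr0 mul1r enorm0 add0r.
pose f x y := q *: x + y.
have fB x y x' y' : f x y - f x' y' = q *: (x - x') + (y - y').
  by rewrite /f scalerBr opprD addrACA.
have sepf x y x' y' : x \in s -> y \in c -> x' \in s -> y' \in c ->
    (x, y) != (x', y') -> nu <= enorm (f x y - f x' y').
  move=> xs yc x's y'c; rewrite fB xpair_eqE; have [->|xx'] := eqVneq x x'.
    by rewrite subrr scaler0 add0r => /= yy'; exact: sepc.
  move=> _; rewrite -[y - y']opprK; apply: le_trans (enormB_ge _ _).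
  rewrite enormN enormZ ger0_norm//.
  have := seps _ _ xs x's xx'; have := diamc _ _ yc y'c => h1 h2.
  by have := ler_wpM2l q0 h2; rewrite qnu; lra.
exists [seq f x y | x <- s, y <- c]; first by rewrite size_allpairs sizes expnSr.
split; last first.
  move=> _ _ /allpairsP[[x y] /= [xs yc ->]] /allpairsP[[x' y'] /= [x's y'c ->]].
  rewrite fB; have := enormD (q *: (x - x')) (y - y').
  rewrite enormZ ger0_norm//.
  have := ler_wpM2l q0 (diams _ _ xs x's); have := diamc _ _ yc y'c.
  by rewrite exprS mulrDr qnu -mulrA; lra.
split.
  apply: allpairs_uniq => // -[x y] [x' y'] /allpairsP[[x1 y1] /= [xs yc [-> ->]]].
  move=> /allpairsP[[x2 y2] /= [x's y'c [-> ->]]] fE.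
  apply/eqP/negPn/negP => ne; have := sepf _ _ _ _ xs yc x's y'c ne.
  by rewrite fE subrr enorm0 leNgt nu0.
move=> _ _ /allpairsP[[x y] /= [xs yc ->]] /allpairsP[[x' y'] /= [x's y'c ->]] ne.
by apply: sepf => //; apply: contra ne => /eqP[-> ->].
Qed.

(** Points are sent to cells of side [nu / d.+1]. Two points of one cell differ by at most
    [d * nu / d.+1 < nu] in the sum norm, so the map is injective. Using [d.+1] keeps the inequality
    strict and covers [d = 0]. *)
Lemma separated_grid nu D s : 0 < nu -> 0 <= D -> separated nu s ->
  {in s &, forall x y, enorm (x - y) <= D} ->
  (size s)%:R <= (2 * d.+1%:R * D / nu + 1) ^+ d.
Proof.
move=> nu0 D0 [us seps] diams.
case: s us seps diams => [_ _ _|x0 s' us seps diams].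
  by rewrite exprn_ge0// addr_ge0// !mulr_ge0// invr_ge0 ltW.
set s := x0 :: s' in us seps diams *.
have x0s : x0 \in s by rewrite inE eqxx.
(* Coordinates relative to [x0], shifted by [D] to be nonnegative and measured in cell sides. *)
pose z x i := (x ord0 i - x0 ord0 i + D) * (d.+1%:R / nu).
have dn0 : 0 < d.+1%:R / nu :> R by rewrite divr_gt0.
pose B := 2 * d.+1%:R * D / nu.
have zB x i : x \in s -> 0 <= z x i <= B.
  move=> xs; have := le_trans (coord_le_enorm (x - x0) i) (diams _ _ xs x0s).
  rewrite !mxE ler_norml => /andP[h1 h2]; apply/andP; split.
    by apply: mulr_ge0; [lra|exact: ltW].
  have -> : B = 2 * D * (d.+1%:R / nu) by rewrite /B; ring.
  by apply: ler_wpM2r; [exact: ltW|lra].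
pose m := Num.truncn B.
pose F x : {ffun 'I_d -> 'I_m.+1} := [ffun i => inord (Num.truncn (z x i))].
have Fz x i : x \in s -> F x i = Num.truncn (z x i) :> nat.
  move=> xs; rewrite ffunE inordK// ltnS; have /andP[z0 zb] := zB x i xs.
  exact: le_truncn.
have Finj : {in s &, injective F}.
  move=> x y xs ys Fxy; apply/eqP/negPn/negP => xy.
  have := seps _ _ xs ys xy; apply/negP; rewrite -ltNge.
  apply: le_lt_trans (enorm_le_sum _) _.
  have small (i : 'I_d) : `|(x - y) ord0 i| <= nu / d.+1%:R.
    have /andP[zx0 _] := zB x i xs; have /andP[zy0 _] := zB y i ys.
    have e : Num.truncn (z x i) = Num.truncn (z y i) by rewrite -!Fz// Fxy.
    have /andP[a1 a2] := truncn_itv zx0; have /andP[b1 b2] := truncn_itv zy0.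
    rewrite e in a1 a2.
    have zd : z x i - z y i = (x - y) ord0 i * (d.+1%:R / nu).
      by rewrite /z !mxE; ring.
    have : `|z x i - z y i| <= 1.
      by rewrite ler_norml; move: a2 b2; rewrite -!natr1; lra.
    by rewrite zd normrM (gtr0_norm dn0) -ler_pdivlMr// mul1r invf_div.
  apply: le_lt_trans (ler_sum _ (fun i _ => small i)) _.
  rewrite sumr_const card_ord -[ltLHS]mulr_natl mulrA ltr_pdivrMr// mulrC ltr_pM2l//.
  by rewrite ltr_nat.
have : (size s <= m.+1 ^ d)%N.
  rewrite -(size_map F) -[X in (_ <= X ^ _)%N]card_ord -[X in (_ <= _ ^ X)%N]card_ord.
  rewrite -card_ffun; have /card_uniqP <- : uniq (map F s) by rewrite map_inj_in_uniq.
  exact: max_card.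
rewrite -(ler_nat R) natrX => /le_trans; apply.
apply: lerXn2r; rewrite ?nnegrE//.
  by rewrite addr_ge0// !mulr_ge0// invr_ge0 ltW.
rewrite -natr1 lerD2r.
by rewrite truncn_le !mulr_ge0// invr_ge0 ltW.
Qed.

(** If [b < a], Bernoulli's inequality makes the powers of [a / b] exceed [C]. *)
Lemma ler_of_exprn_le (a b C : R) : 0 <= C -> 0 < b ->
  (forall j, a ^+ j <= C * b ^+ j) -> a <= b.
Proof.
move=> C0 b0 h; rewrite leNgt; apply/negP => ba.
pose r := a / b - 1.
have r0 : 0 < r by rewrite subr_gt0 ltr_pdivlMr// mul1r.
have bern j : 1 + j%:R * r <= (1 + r) ^+ j.
  elim: j => [|j ih]; first by rewrite mul0r addr0 expr0.
  rewrite exprS; apply: (@le_trans _ _ ((1 + r) * (1 + j%:R * r))).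
    rewrite -natr1; have : 0 <= j%:R * r * r by rewrite !mulr_ge0// ltW.
    by lra.
  by apply: ler_wpM2l => //; lra.
have [j _] : exists2 j, true & C < j%:R * r.
  exists (Num.truncn (C / r)).+1 => //.
  by rewrite -ltr_pdivrMr//; exact: truncnS_gt.
apply/negP; rewrite -leNgt.
have := h j; rewrite -ler_pdivrMr ?exprn_gt0// -expr_div_n.
have -> : a / b = 1 + r by rewrite /r; ring.
by have := bern j; lra.
Qed.

(** The grid bound for the [j]-th iterate is [(q ^+ d) ^+ j] up to a factor independent of [j],
    which [ler_of_exprn_le] removes. *)
Lemma separated_size_le nu D c : 0 < nu -> 0 <= D -> separated nu c ->
  {in c &, forall x y, enorm (x - y) <= D} ->
  (size c)%:R <= (D / nu + 1) ^+ d.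
Proof.
move=> nu0 D0 sepc diamc; set q := D / nu + 1.
have q1 : 1 <= q by rewrite lerDr divr_ge0// ltW.
apply: (@ler_of_exprn_le _ _ ((2 * d.+1%:R + 1) ^+ d)).
- by rewrite exprn_ge0// addr_ge0// mulr_ge0.
- by rewrite exprn_gt0// (lt_le_trans ltr01).
move=> j; have [s sizes [seps diams]] := separated_iter j nu0 D0 sepc diamc.
rewrite -natrX -sizes -exprM mulnC exprM -exprMn.
have qj0 : 0 <= q ^+ j * nu by rewrite mulr_ge0 ?exprn_ge0 ?(ltW nu0)// (le_trans ler01).
apply: (@le_trans _ _ ((2 * d.+1%:R * (q ^+ j * nu) / nu + 1) ^+ d)).
  apply: separated_grid => // x y xs ys.
  by have := diams x y xs ys; rewrite -/q; lra.
apply: lerXn2r; rewrite ?nnegrE.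
- by rewrite addr_ge0// !mulr_ge0// ?exprn_ge0 ?invr_ge0 ?(ltW nu0)// (le_trans ler01).
- by apply: mulr_ge0; [rewrite addr_ge0// mulr_ge0|exact: exprn_ge0 (le_trans ler01 q1)].
(* Since [1 <= q ^+ j], the summand 1 is absorbed into the constant factor. *)
- rewrite mulrA mulfK ?gt_eqF//; move: (exprn_ege1 j q1); move: (q ^+ j) => t; lra.
Qed.

(** Without a net, every separated list in [Theta] could be extended by a point farther than [nu]
    from all its members, against the size bound. *)
Lemma exists_net (Theta : set 'rV[R]_d) nu D : 0 < nu -> 0 <= D ->
  (forall x y, Theta x -> Theta y -> enorm (x - y) <= D) ->
  exists s, [/\ forall x, x \in s -> Theta x,
    (size s)%:R <= (D / nu + 1) ^+ d &
    forall x, Theta x -> exists2 y, y \in s & enorm (x - y) <= nu].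
Proof.
move=> nu0 D0 diamT.
have sz s : (forall x, x \in s -> Theta x) -> separated nu s ->
    (size s)%:R <= (D / nu + 1) ^+ d.
  by move=> sT seps; apply: separated_size_le => // x y /sT xT /sT yT; exact: diamT.
apply: contrapT => nonet.
have grow n : exists2 s, size s = n & (forall x, x \in s -> Theta x) /\ separated nu s.
  elim: n => [|n [s sizes [sT [us seps]]]]; first by exists [::].
  have [x Tx xs] : exists2 x, Theta x & forall y, y \in s -> nu < enorm (x - y).
    apply: contrapT => h; apply: nonet; exists s; split => //; first exact: sz.
    move=> x Tx; apply: contrapT => h'; apply: h; exists x => // y ys.
    by rewrite ltNge; apply/negP => le; apply: h'; exists y.
  exists (x :: s); first by rewrite /= sizes.
  split; first by move=> y; rewrite inE => /predU1P[->//|]; exact: sT.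
  split.
    by rewrite /= us andbT; apply/negP => /xs; rewrite subrr enorm0 ltNge ltW.
  move=> y z; rewrite !inE => /predU1P[->|ys] /predU1P[->|zs].
  - by rewrite eqxx.
  - by move=> _; exact/ltW/xs.
  - by move=> _; rewrite -enormN opprB; exact/ltW/xs.
  - exact: seps.
have [s sizes [sT seps]] := grow (Num.truncn ((D / nu + 1) ^+ d)).+1.
have := sz s sT seps; rewrite sizes leNgt.
by rewrite truncnS_gt.
Qed.

End packing.

(** * Approximate minimisers *)

Section diameter.
Context (R : realType) (d : nat).
Implicit Types (Theta : set 'rV[R]_d) (x y : 'rV[R]_d).

Lemma enorm_le_diam Theta x y : compact Theta -> Theta x -> Theta y ->
  enorm (x - y) <= diam Theta.
Proof.
move=> /compact_bounded[B [_ hB]] Tx Ty.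
(* The ambient norm on row vectors is the maximum norm, so boundedness is read coordinatewise. *)
have {}hB z : Theta z -> forall i, `|z ord0 i| <= B + 1.
  move=> Tz i; apply: le_trans (hB (B + 1) _ _ Tz); last by rewrite ltrDl.
  rewrite {2}/Num.norm /= mx_normrE.
  exact: (le_bigmax _ (fun ij => `|z ij.1 ij.2|) (ord0, i)).
apply: ub_le_sup; last by exists x => //; exists y.
exists (\sum_(i < d) (2 * (B + 1))) => _ [a Ta [b Tb <-]].
apply: le_trans (enorm_le_sum _) _; apply: ler_sum => i _.
rewrite !mxE (le_trans (ler_normB _ _))//.
by have := hB a Ta i; have := hB b Tb i; lra.
Qed.

Lemma diam_ge0 Theta : compact Theta -> 0 <= diam Theta.
Proof.
move=> cT; have [[x Tx]|/forallNP T0] := pselect (exists x, Theta x).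
  exact: le_trans (enorm_ge0 _) (enorm_le_diam cT Tx Tx).
rewrite /diam [X in sup X](_ : _ = set0) ?sup0//.
by apply/seteqP; split => // x [a Ta _]; case: (T0 _ Ta).
Qed.

End diameter.

(** The deterministic part. In units of [eps - delta] the losses are 1/8 for each of the two moves
    between [th] and the net point, 1/2 for the deviation and 1/4 for [ths]; they add up to 1. *)
Lemma near_min_subset (R : realType) (d : nat) (G Gh : 'rV[R]_d -> R)
    (Theta : set 'rV[R]_d) (s : seq 'rV[R]_d) (ths : 'rV[R]_d)
    (K D nu delta eps : R) :
  0 <= K -> K * nu = (eps - delta) / 8 ->
  (forall x y, Theta x -> Theta y -> enorm (x - y) <= D) ->
  (forall x y, Theta x -> Theta y -> G x - G y <= K * enorm (x - y)) ->
  (forall x y, Theta x -> Theta y -> Gh x - Gh y <= K * enorm (x - y)) ->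
  Theta ths -> G ths <= inf (G @` Theta) + (eps - delta) / 4 ->
  (forall x, x \in s -> Theta x) ->
  (forall x, Theta x -> exists2 y, y \in s & enorm (x - y) <= nu) ->
  (forall y, y \in s -> Gh ths - Gh y < G ths - G y + (eps - delta) / 2) ->
  near_min Gh Theta delta `<=` near_min G Theta eps.
Proof.
move=> K0 Knu TD lipG lipGh Tths Gths sT net dev th [Tth Ghth]; split => //.
have [y ys thy] := net _ Tth; have Ty := sT _ ys.
(* The infimum lies below its values only for a set bounded below, which the Lipschitz bound and [D]
   provide. *)
have infGh : inf (Gh @` Theta) <= Gh ths.
  apply: ge_inf; last by exists ths.
  exists (Gh ths - K * D) => _ [x Tx <-].
  have := lipGh _ _ Tths Tx; have := ler_wpM2l K0 (TD _ _ Tths Tx); lra.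
have := lipG _ _ Tth Ty; have := lipGh _ _ Ty Tth.
rewrite -[enorm (y - th)]enormN opprB.
have := ler_wpM2l K0 thy; have := dev _ ys; lra.
Qed.

Lemma measure_bigsetU_seq_le d (T : measurableType d) (R : realType)
    (m : {measure set T -> \bar R}) (I : eqType) (s : seq I) (F : I -> set T)
    (c : R) :
  (forall i, i \in s -> measurable (F i) /\ (m (F i) <= c%:E)%E) ->
  let U := \big[setU/set0]_(i <- s) F i in
  measurable U /\ (m U <= ((size s)%:R * c)%:E)%E.
Proof.
elim: s => [|i s ih] h /=.
  by rewrite big_nil measure0 mul0r.
have [mi ci] := h i (mem_head _ _).
have [|mU cU] := ih; first by move=> j js; apply: h; rewrite inE js orbT.
rewrite big_cons; split; first exact: measurableU.
apply: (le_trans (measureU2 _ mi mU)).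
by rewrite -addn1 natrD mulrDl mul1r addrC EFinD leeD.
Qed.


(** * Lipschitz constants of the true and empirical objectives *)

Lemma Gfun_lip dO d1 d2 (Om : measurableType dO) (X : measurableType d1)
    (Y : measurableType d2) (R : realType) (d : nat) (P : probability Om R)
    (Xv : Om -> X) (Yv : Om -> Y) (g : 'rV[R]_d -> X -> Y -> R)
    (L : X -> Y -> R) (Lbar : R) (Nul : set (X * Y)) (th th' : 'rV[R]_d) :
  measurable_fun setT Xv -> measurable_fun setT Yv ->
  P.-integrable setT (fun w => (g th (Xv w) (Yv w))%:E) ->
  P.-integrable setT (fun w => (g th' (Xv w) (Yv w))%:E) ->
  measurable_fun setT (fun p : X * Y => L p.1 p.2) ->
  (forall x y, 0 < L x y) ->
  (\int[P]_w (L (Xv w) (Yv w))%:E)%E = Lbar%:E ->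
  measurable Nul -> P ((fun w => (Xv w, Yv w)) @^-1` Nul) = 0%E ->
  (forall x y, ~ Nul (x, y) ->
    `|g th x y - g th' x y| <= L x y * enorm (th - th')) ->
  Gfun P Xv Yv g th - Gfun P Xv Yv g th' <= Lbar * enorm (th - th').
Proof.
move=> mXv mYv ig ig' mL L0 intL mNul PNul lip.
have mXY : measurable_fun setT (fun w => (Xv w, Yv w)) by exact: measurable_fun_pair.
pose D w := g th (Xv w) (Yv w) - g th' (Xv w) (Yv w).
have iD : P.-integrable setT (fun w => (D w)%:E).
  exact: (integrableB measurableT ig ig').
have mLw : measurable_fun setT (fun w => L (Xv w) (Yv w)).
  exact: (measurableT_comp mL mXY).
have -> : Gfun P Xv Yv g th - Gfun P Xv Yv g th' = fine (\int[P]_w (D w)%:E)%E.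
  rewrite integralB_EFin// fineB//; exact: integrable_fin_num.
rewrite -lee_fin fineK; last exact: integrable_fin_num.
apply: le_trans (lee_abs _) _.
apply: le_trans (le_abse_integral _ measurableT (measurable_int _ iD)) _.
rewrite EFinM -intL -ge0_integralZr//; last first.
- by rewrite lee_fin enorm_ge0.
- by move=> w _; rewrite lee_fin ltW.
- exact/measurable_EFinP.
apply: ae_ge0_le_integral => //.
- by apply: measurableT_comp => //; exact: measurable_int iD.
- by move=> w _; rewrite -EFinM lee_fin mulr_ge0 ?enorm_ge0// ltW.
- apply/measurable_EFinP; exact: measurable_funM.
exists ((fun w => (Xv w, Yv w)) @^-1` Nul); split => //.
  by rewrite -[X in measurable X]setTI; exact: mXY.
move=> w /= nw; apply: contrapT => nNul; apply: nw => _.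
by rewrite lee_fin lip.
Qed.

Lemma Ghat_lip Om d1 d2 (X : measurableType d1) (Y : measurableType d2)
    (R : realType) (d M N : nat) (g : 'rV[R]_d -> X -> Y -> R)
    (L : X -> Y -> R) (Ys : 'I_M -> Om -> Y) (Xs : 'I_M -> 'I_N -> Om -> X)
    (w : Om) (th th' : 'rV[R]_d) :
  (forall k l, `|g th (Xs k l w) (Ys k w) - g th' (Xs k l w) (Ys k w)|
     <= L (Xs k l w) (Ys k w) * enorm (th - th')) ->
  Ghat g Ys Xs w th - Ghat g Ys Xs w th' <=
  (M * N)%:R^-1 * (\sum_(k < M) \sum_(l < N) L (Xs k l w) (Ys k w))
    * enorm (th - th').
Proof.
move=> lip; rewrite /Ghat -mulrBr -mulrA ler_wpM2l ?invr_ge0//.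
rewrite -sumrB mulr_suml; apply: ler_sum => k _.
rewrite -sumrB mulr_suml; apply: ler_sum => l _.
exact: le_trans (ler_norm _) (lip k l).
Qed.

(** The failure event is enclosed in a measurable [E], so its own measurability is not at issue.
    Having the bound for every [L' > Lbar] amounts to having it for the infimum. *)
Theorem mainTheorem4
  (R : realType) (d : nat)
  (dO d1 d2 : measure_display)
  (Om : measurableType dO) (X : measurableType d1) (Y : measurableType d2)
  (P : probability Om R) (Xv : Om -> X) (Yv : Om -> Y)
  (kappa : R.-pker Y ~> X)
  (g : 'rV[R]_d -> X -> Y -> R)
  (Theta : set 'rV[R]_d) (delta eps : R)
  (L : X -> Y -> R) (Lbar l1 l2 b1 b2 : R) :
  measurable_fun setT Xv -> measurable_fun setT Yv ->
  reg_cond_distr P Xv Yv kappa ->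
  (forall th, Theta th ->
     measurable_fun setT (fun p : X * Y => g th p.1 p.2)) ->
  (forall th, Theta th ->
     P.-integrable setT (fun w => (g th (Xv w) (Yv w))%:E)) ->
  compact Theta -> convexR Theta ->
  0 < delta -> delta < eps ->
  measurable_fun setT (fun p : X * Y => L p.1 p.2) ->
  (forall x y, 0 < L x y) ->
  (exists2 eta : R, 0 < eta & forall t : R, `|t| < eta ->
     P.-integrable setT (fun w => (expR (t * L (Xv w) (Yv w)))%:E)) ->
  (* a.s. (w.r.t. the law of (X,Y)), for all theta theta' in Theta: Lipschitz *)
  (exists Nul : set (X * Y), [/\ measurable Nul,
     P ((fun w => (Xv w, Yv w)) @^-1` Nul) = 0%E &
     forall x y, ~ Nul (x, y) -> forall th th', Theta th -> Theta th' ->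
       `|g th x y - g th' x y| <= L x y * enorm (th - th')]) ->
  (\int[P]_w (L (Xv w) (Yv w))%:E)%E = Lbar%:E ->
  0 < l1 -> 0 < l2 ->
  {ae P, forall w, `|L (Xv w) (Yv w) - condE kappa L (Yv w)| <= l1} ->
  {ae P, forall w, `|condE kappa L (Yv w) - Lbar| <= l2} ->
  0 < b1 -> 0 < b2 ->
  (forall (t : R) th th', Theta th -> Theta th' ->
     {ae P, forall w,
       (\int[kappa (Yv w)]_x
          (expR (t * (g th' x (Yv w) - g th x (Yv w))))%:E
        <= (expR (condE kappa (fun x y => g th' x y - g th x y) (Yv w) * t
                  + b1 ^+ 2 * t ^+ 2 / 2))%:E)%E}) ->
  (forall (t : R) th th', Theta th -> Theta th' ->
     (\int[P]_w
        (expR (t * condE kappa (fun x y => g th' x y - g th x y) (Yv w)))%:E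
      <= (expR ((Gfun P Xv Yv g th' - Gfun P Xv Yv g th) * t
                + b2 ^+ 2 * t ^+ 2 / 2))%:E)%E) ->
  forall (M N : nat), (0 < M)%N -> (0 < N)%N ->
  forall (dO' : measure_display) (Om' : measurableType dO')
    (P' : probability Om' R)
    (Ys : 'I_M -> Om' -> Y) (Xs : 'I_M -> 'I_N -> Om' -> X),
  hier_sample P Yv kappa P' Ys Xs ->
  forall L' : R, Lbar < L' ->
  exists E : set Om', [/\ measurable E,
    [set w | ~ (near_min (Ghat g Ys Xs w) Theta delta
                `<=` near_min (Gfun P Xv Yv g) Theta eps)] `<=` E &
    (P' E <= ((((8 * L' * diam Theta / (eps - delta) + 1) ^+ d + 1)
              * expR (- (M%:R * (eps - delta) ^+ 2)
                      / (8 * (b1 ^+ 2 / N%:R + b2 ^+ 2))))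
            + expR (- (M%:R * (L' - Lbar) ^+ 2)
                    / (2 * (l1 ^+ 2 / N%:R + l2 ^+ 2))))%:E)%E].
Proof.
move=> mXv mYv rcd mg ig cT _ delta0 deltaeps mL L0 _ [Nul [mNul PNul lip]] intL
  l10 l20 hL1 hL2 b10 b20 hb1 hb2 M N M0 N0 dO' Om' P' Ys Xs hs L' LL'.
set e1 := expR (- (M%:R * (eps - delta) ^+ 2) / _).
set e2 := expR (- (M%:R * (L' - Lbar) ^+ 2) / _).
pose D := diam Theta.
have D0 : 0 <= D by exact: diam_ge0.
have TD x y : Theta x -> Theta y -> enorm (x - y) <= D by exact: enorm_le_diam.
have Lbar0 : 0 <= Lbar.
  by rewrite -lee_fin -intL; apply: integral_ge0 => w _; rewrite lee_fin ltW.
have L'0 : 0 < L' by exact: le_lt_trans LL'.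
have ed0 : 0 < eps - delta by rewrite subr_gt0.
(* For empty [Theta] both sets of near-minimisers are empty and nothing can fail. *)
have [[th0 Tth0]|/forallNP T0] := pselect (exists x, Theta x); last first.
  exists set0; split => //.
    by move=> w /= H; exfalso; apply: H => th [/T0].
  rewrite measure0 lee_fin addr_ge0 ?expR_ge0// mulr_ge0 ?expR_ge0//.
  by rewrite addr_ge0// exprn_ge0// addr_ge0// divr_ge0 ?mulr_ge0// ltW.
pose nu := (eps - delta) / (8 * L').
have nu0 : 0 < nu by rewrite divr_gt0// mulr_gt0.
have Knu : L' * nu = (eps - delta) / 8 by rewrite /nu; field; rewrite gt_eqF.
have qE : 8 * L' * D / (eps - delta) + 1 = D / nu + 1.
  by rewrite /nu; congr (_ + 1); field; rewrite !gt_eqF//.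
have [s [sT sizes net]] := exists_net nu0 D0 TD.
have lipG x y : Theta x -> Theta y ->
    Gfun P Xv Yv g x - Gfun P Xv Yv g y <= L' * enorm (x - y).
  move=> Tx Ty; apply: (@le_trans _ _ (Lbar * enorm (x - y))).
    apply: (@Gfun_lip _ _ _ _ _ _ _ _ P Xv Yv g L Lbar Nul) => //; try exact: ig.
    by move=> a b /lip; exact.
  by rewrite ler_wpM2r ?enorm_ge0// ltW.
have [_ [ths Tths <-] /ltW Gths] : exists2 v, (Gfun P Xv Yv g @` Theta) v &
    v < inf (Gfun P Xv Yv g @` Theta) + (eps - delta) / 4.
  apply: inf_adherent; first by rewrite divr_gt0.
  split; first by exists (Gfun P Xv Yv g th0); exists th0.
  exists (Gfun P Xv Yv g th0 - L' * D) => _ [x Tx <-].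
  by have := lipG _ _ Tth0 Tx; have := ler_wpM2l (ltW L'0) (TD _ _ Tth0 Tx); lra.
pose G := Gfun P Xv Yv g.
pose Gh := Ghat g Ys Xs.
(* The bad events: a sample point in the exceptional set [Nul], a large empirical mean of [L], and a
   deviation at a net point. *)
pose ENul (p : 'I_M * 'I_N) := (fun w => (Xs p.1 p.2 w, Ys p.1 w)) @^-1` Nul.
pose EL := [set w | L' <=
  (M * N)%:R^-1 * \sum_(k < M) \sum_(l < N) L (Xs k l w) (Ys k w)].
pose Edev th := [set w | G ths - G th + (eps - delta) / 2 <= Gh w ths - Gh w th].
have [mYs mXs _] := hs.
have [mU1 U1] : let U := \big[setU/set0]_(p <- enum {: 'I_M * 'I_N}) ENul p in
    measurable U /\ (P' U <= ((size (enum {: 'I_M * 'I_N}))%:R * 0)%:E)%E.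
  apply: measure_bigsetU_seq_le => p _; split.
    by rewrite -[ENul _]setTI; apply: measurable_fun_pair.
  rewrite le_eqVlt; apply/orP; left; apply/eqP.
  exact: etrans (hier_sample_marginal mXv mYv hs p.1 p.2 mNul rcd) PNul.
have [mU2 U2] : let U := \big[setU/set0]_(th <- s) Edev th in
    measurable U /\ (P' U <= ((size s)%:R * e1)%:E)%E.
  apply: measure_bigsetU_seq_le => th /sT Tth.
  have mh : measurable_fun setT (fun p : X * Y => g ths p.1 p.2 - g th p.1 p.2).
    by apply: measurable_funB; exact: mg.
  have := @hier_sample_tail _ _ _ _ _ _ _ _ _ P Yv kappa mYv P' M N Ys Xs hs
    (fun x y => g ths x y - g th x y) (condE kappa (fun x y => g ths x y - g th x y))
    (G ths - G th) b1 b2 ((eps - delta) / 2) M0 N0 b10 b20 _ mh (measurable_condE kappa mh)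
    (fun t => hb1 t _ _ Tth Tths) (fun t => hb2 t _ _ Tth Tths).
  have -> : [set w | G ths - G th + (eps - delta) / 2 <= (M * N)%:R^-1 *
      \sum_(k < M) \sum_(l < N) (g ths (Xs k l w) (Ys k w) - g th (Xs k l w) (Ys k w))]
      = Edev th.
    apply/funext => w; rewrite /Edev /= /Gh /Ghat -mulrBr -sumrB.
    by under [in RHS]eq_bigr do rewrite -sumrB.
  (* The deviation level [(eps - delta) / 2] turns the 2 of the Chernoff exponent into 8. *)
  have -> : - (M%:R * ((eps - delta) / 2) ^+ 2) / (2 * (b1 ^+ 2 / N%:R + b2 ^+ 2)) =
      - (M%:R * (eps - delta) ^+ 2) / (8 * (b1 ^+ 2 / N%:R + b2 ^+ 2)).
    have B0 : b1 ^+ 2 / N%:R + b2 ^+ 2 != 0.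
      by rewrite gt_eqF// addr_gt0 ?divr_gt0 ?exprn_gt0 ?ltr0n.
    move: (b1 ^+ 2 / N%:R + b2 ^+ 2) B0 => B B0; by field.
  by apply; rewrite divr_gt0.
have [mEL PEL] : measurable EL /\ (P' EL <= e2%:E)%E.
  have := @hier_sample_tail _ _ _ _ _ _ _ _ _ P Yv kappa mYv P' M N Ys Xs hs
    L (condE kappa L) Lbar l1 l2 (L' - Lbar) M0 N0 l10 l20 _ mL (measurable_condE kappa mL)
    (condE_mgf_le mXv mYv rcd mL l10 hL1) (mgf_condE_le mXv mYv rcd mL L0 intL l20 hL2).
  rewrite /= (addrC Lbar) subrK; apply; by rewrite subr_gt0.
exists (\big[setU/set0]_(p <- enum {: 'I_M * 'I_N}) ENul p `|` EL
  `|` \big[setU/set0]_(th <- s) Edev th); split.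
- by apply: measurableU => //; exact: measurableU.
- move=> w /= ninc; apply: contrapT => /not_orP[/not_orP[nNul nEL] nDev]; apply: ninc.
  (* One [Nul] serves all pairs of parameters, so the Lipschitz bound reaches minimisers that depend
     on [w]. *)
  have {}nNul k l : ~ Nul (Xs k l w, Ys k w).
    move=> Nulw; apply: nNul; rewrite -bigcup_seq; exists (k, l) => //=.
    by rewrite mem_enum.
  apply: (@near_min_subset _ _ G (Gh w) Theta s ths L' D nu) => //; first exact: ltW.
    move=> x y Tx Ty; apply: le_trans (Ghat_lip (L := L) _) _.
      by move=> k l; apply: lip.
    rewrite ler_wpM2r ?enorm_ge0// ltW// ltNge; exact/negP.
  move=> y ys; rewrite ltNge; apply/negP => le; apply: nDev.
  by rewrite -bigcup_seq; exists y.
- apply: (le_trans (measureU2 _ (measurableU _ _ mU1 mEL) mU2)).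
  apply: (@le_trans _ _ ((0 + e2%:E) + ((size s)%:R * e1)%:E)%E).
    apply: leeD => //; apply: (le_trans (measureU2 _ mU1 mEL)).
    by rewrite mulr0 in U1; exact: leeD.
  (* The number of deviation events is at most [q ^+ d], below the stated [q ^+ d + 1]. *)
  rewrite add0e -EFinD lee_fin addrC lerD2r ler_wpM2r ?expR_ge0//.
  by rewrite -/D qE (le_trans sizes)// lerDl.
Qed.
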